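(* Let $k \ge 1$ and $\ell \ge 0$ be integers. There exists $n_0 = n_0(k,\ell)$ such that for all $n \ge n_0$, all integers $t \ge 0$, and all integers $m$ with $$\binom{n}{k} - \binom{n-\ell}{k} \le m \le \binom{n}{k} - \binom{n-\ell}{k} + n - \ell - k + 1,$$ every $k$-uniform family $\mathcal{F} \subseteq \binom{[n]}{k}$ with $m$ sets satisfies $$\mathrm{int}(\mathcal{F},t) \le \mathrm{int}(\mathcal{L}_{n,k}(m),t).$$
   Context: $[n]=\{1,\dots,n\}$, and $\binom{X}{k}$ denotes the set of $k$-element subsets of $X$. A family of sets is intersecting if any two of its members have non-empty intersection (the empty family is intersecting). $\mathrm{int}(\mathcal{F},t)$ is the number of intersecting subfamilies of $\mathcal{F}$ consisting of exactly $t$ sets. The lexicographic order on $\binom{[n]}{k}$ is: for $A\neq B$, $A<B$ if $\min(A \triangle B) \in A$. $\mathcal{L}_{n,k}(m)$ is the family of the first $m$ sets of $\binom{[n]}{k}$ in this order. *)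

(* Defs.v *)
From mathcomp Require Import all_boot.

Set Implicit Arguments.
Unset Strict Implicit.
Unset Printing Implicit Defensive.

(* The ground set [n] = {1, ..., n} is 'I_n = {0, ..., n-1}: the shift by one
   preserves the order, hence also the lexicographic order below. *)

Definition ksets (n k : nat) : {set {set 'I_n}} := [set A : {set 'I_n} | #|A| == k].

Definition intersecting (T : finType) (F : {set {set T}}) : bool :=
  [forall A in F, forall B in F, A :&: B != set0].

Definition int_count (T : finType) (F : {set {set T}}) (t : nat) : nat :=
  #|[set G : {set {set T}} | [&& G \subset F, #|G| == t & intersecting G]]|.

Definition symdiff (T : finType) (A B : {set T}) : {set T} :=
  (A :\: B) :|: (B :\: A).

(* Some i is the minimum of symdiff A B and lies in A; in particular A != B. *)
Definition lex_lt (n : nat) (A B : {set 'I_n}) : bool :=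
  [exists i : 'I_n, [&& i \in symdiff A B,
                        [forall j in symdiff A B, i <= j] & i \in A]].

Definition lex_le (n : nat) (A B : {set 'I_n}) : bool :=
  (A == B) || lex_lt A B.

Definition lex_family (n k m : nat) : {set {set 'I_n}} :=
  [set A in take m (sort (@lex_le n) (enum (ksets n k)))].

(* Main.v *)
Require Import Defs.
From mathcomp Require Import all_boot zify.

Set Implicit Arguments.
Unset Strict Implicit.
Unset Printing Implicit Defensive.

(** Write [S_X] for the family of the [k]-sets that meet [X], [N] for the number
    ['C(n - 1, k - 1)] of [k]-sets through a point, and call the intersecting
    subfamilies with [t] members [t]-families.  For [m] in the given range the first
    [m] sets form [S_X], where [X] consists of the first [l] points, together with
    at most [n - l - k + 1] sets that contain one common [k.-1]-set; this is
    [lex_family_structure].  If [t <= 1], or [k = 1], or [l = 0], the bound is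
    immediate: in the last case the initial segment is itself intersecting, unless
    [k = 1].

    In the other cases [F] either has too few [t]-families, or is brought, by
    exchanges that never lower their number, to a family that contains [S_C] for
    some [C] with [l] points ([int_count_le_lex_big]).  Suppose that [S_C] is
    contained in [F], that [C] has fewer than [l] points, and let [v] be a point
    outside [C] of largest degree [D].

    - If [D] is a small fraction of [N], then [F] already loses: apart from a
      negligible number of exceptions, each [t]-family lies in the star of a point of
      [C] ([int_count_stars_le]), while the initial segment has almost
      [l * 'C(N, t)] of them ([int_count_touching_ge]).
    - If some member of [F] avoids [C] and [v] and meets at most [D] other members,
      it is traded for a new set through [v] ([int_count_swap]).
    - Otherwise all members of [F] meet a set of bounded size with more than [l]
      points, each of large degree.  For [k > 2] the points outside [C] have almost
      equal degrees and [m] is almost [l * N], so convexity of ['C(_, t)] shows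
      that [F] loses ([int_count_le_of_stuck]).  For [k = 2], where [m] may be close
      to [l.+1 * N], several edges at one point are moved at once to make [v]
      heavier, with an exact count ([move_edges], [graph_climb]).

    Finally let [F] contain [S_C] with [C] of size [l] ([int_count_full_le]), and
    sort the [t]-families by their set [H] of members outside [S_C].  The rest is an
    intersecting family of sets of [S_C] that meet every member of [H].  If the
    members of [H] share a [k.-1]-set, relabelling the points turns [H] into any
    subfamily of the same size of the additional sets of the initial segment
    ([sunflower_hitting_le]).  If not, let [D] be the set of the at most [k - 2]
    common points of [H].  All but [O(n ^ (k - 3))] of the sets of [S_C] that meet
    every member of [H] also meet [D], and these exceptions contribute less than the
    sets through one further point would ([int_count_transversal_le]); but the
    initial segment offers all the sets of [S_X] that meet a [k.-1]-set. *)

(** * Binomial coefficients *)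

(** One term of Vandermonde's identity. *)
Lemma bin_mul_le a b j s : 'C(a, j) * 'C(b, s) <= 'C(a + b, j + s).
Proof.
elim: a j => [|a IH] [|j]; rewrite ?bin0 ?mul1n ?add0n ?bin0n ?mul0n //.
  by rewrite leq_bin2l // leq_addl.
by rewrite addSn addSn !binS mulnDl leq_add // -addSn IH.
Qed.

Lemma bin_add_le a b s : 'C(a, s.+1) + 'C(b, s.+1) <= 'C(a + b, s.+1).
Proof.
elim: a => [|a IH]; first by rewrite bin0n.
rewrite addSn !binS addnAC; apply: leq_add => //.
by rewrite leq_bin2l // leq_addr.
Qed.

Lemma bin_mulKn K x s : K * 'C(x, s.+1) <= 'C(K * x, s.+1).
Proof.
elim: K => [|K IH]; first by rewrite mul0n.
rewrite mulSn mulSn; apply: leq_trans (bin_add_le _ _ _); lia.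
Qed.

(** Among the [s.+1]-subsets of a set with [w] marked elements, those with no
    marked element and those with exactly one. *)
Lemma bin_gain y w s : 'C(y, s.+1) + w * 'C(y, s) <= 'C(y + w, s.+1).
Proof.
elim: w => [|w IH]; first by rewrite mul0n !addn0.
rewrite addnS binS mulSn.
have := leq_bin2l s (leq_addr w y); lia.
Qed.

Lemma binS_le x s : 'C(x, s.+1) <= x * 'C(x, s).
Proof.
have := mul_bin_left x s.
have : (x - s) * 'C(x, s) <= x * 'C(x, s) by rewrite leq_mul2r leq_subr orbT.
nia.
Qed.

Lemma bin_ratio N D s : D <= N -> N * 'C(D, s.+1) <= D * 'C(N, s.+1).
Proof.
move=> DN; case: D DN => [|D] DN; first by rewrite bin0n muln0.
case: N DN => // N DN.
have h1 := mul_bin_diag D.+1 s; have h2 := mul_bin_diag N.+1 s.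
have h3 : 'C(D, s) <= 'C(N, s) by apply: leq_bin2l.
rewrite /= in h1 h2.
rewrite -(leq_pmul2l (ltn0Sn s)) mulnCA -h1 [X in _ <= X]mulnCA -h2.
by rewrite mulnCA !leq_mul2l h3 !orbT.
Qed.

Lemma bin_ratio2 N D s : D <= N -> N ^ 2 * 'C(D, s.+2) <= D ^ 2 * 'C(N, s.+2).
Proof.
move=> DN; case: D DN => [|D] DN; first by rewrite bin0n muln0.
case: N DN => // N DN.
have h1 := mul_bin_diag D.+1 s.+1; have h2 := mul_bin_diag N.+1 s.+1.
have h3 : 'C(D, s.+1) <= 'C(N, s.+1) by apply: leq_bin2l.
have h4 : N * 'C(D, s.+1) <= D * 'C(N, s.+1) by apply: bin_ratio.
rewrite /= in h1 h2.
rewrite -(leq_pmul2l (ltn0Sn s.+1)) mulnCA -h1 [X in _ <= X]mulnCA -h2.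
rewrite !expnS !expn0 !muln1.
have h5 : N.+1 * 'C(D, s.+1) <= D.+1 * 'C(N, s.+1) by rewrite !mulSn leq_add.
have -> : N.+1 * N.+1 * (D.+1 * 'C(D, s.+1)) = N.+1 * D.+1 * (N.+1 * 'C(D, s.+1)).
  by lia.
have -> : D.+1 * D.+1 * (N.+1 * 'C(N, s.+1)) = N.+1 * D.+1 * (D.+1 * 'C(N, s.+1)).
  by lia.
by rewrite leq_mul2l h5 orbT.
Qed.

Lemma bin_pascal_iter n k c : 'C(n.+1, k.+1) <= 'C(n.+1 - c, k.+1) + c * 'C(n, k).
Proof.
elim: c => [|c IH]; first by rewrite subn0 leq_addr.
apply: leq_trans IH _; rewrite mulSn addnA leq_add2r.
case: (leqP n.+1 c) => h.
  have -> : n.+1 - c = 0 by lia.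
  by rewrite bin0n.
have -> : n.+1 - c = (n.+1 - c.+1).+1 by lia.
rewrite binS leq_add2l leq_bin2l //; lia.
Qed.

(** For [n] large, ['C(_, k.+1)] exceeds any multiple of ['C(n, k)], even after
    [c] elements are removed: their removal costs at most [c * 'C(n, k)]. *)
Lemma bin_dominate K c n k :
  k.+1 * (K + c) <= n.+1 -> K * 'C(n, k) <= 'C(n.+1 - c, k.+1).
Proof.
move=> h; have h1 := mul_bin_diag n.+1 k; rewrite /= in h1.
have h2 := bin_pascal_iter n k c.
have h3 : k.+1 * ((K + c) * 'C(n, k)) <= k.+1 * 'C(n.+1, k.+1).
  by rewrite -h1 mulnA leq_mul2r h orbT.
rewrite leq_pmul2l // mulnDl in h3; lia.
Qed.

Lemma bin_two a b y s : a * b * 'C(y, s) <= 'C(a + b + y, s.+2).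
Proof.
have h1 := bin_mul_le a b 1 1; have h2 := bin_mul_le (a + b) y 2 s.
rewrite !bin1 in h1; apply: leq_trans h2.
by rewrite leq_mul2r h1 orbT.
Qed.

Lemma leq_bin_self n j : 0 < j -> j < n -> n <= 'C(n, j).
Proof.
case: j => // j _; elim: n => // n IH; rewrite ltnS leq_eqVlt => /orP[/eqP<-|jn].
  by rewrite binSn.
rewrite binS; have := IH jn; have : 0 < 'C(n, j) by rewrite bin_gt0 ltnW // ltnW.
lia.
Qed.

(** * Counting intersecting subfamilies *)

Lemma card_bigcup_le (I T : finType) (P : pred I) (X : I -> {set T}) :
  #|\bigcup_(i | P i) X i| <= \sum_(i | P i) #|X i|.
Proof.
elim/big_rec2: _ => [|i n A _ hA]; first by rewrite cards0.
by apply: leq_trans (leq_of_leqif (leq_card_setU _ _)) _; rewrite leq_add2l.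
Qed.

Lemma leq_card_imset_inj (T U : finType) (f : T -> U) (A : {set T}) (B : {set U}) :
  {in A &, injective f} -> {in A, forall x, f x \in B} -> #|A| <= #|B|.
Proof.
move=> inj sub; rewrite -(card_in_imset inj).
by apply: subset_leq_card; apply/subsetP => y /imsetP[x xA ->]; exact: sub.
Qed.

Definition meets (T : finType) (F : {set {set T}}) (A : {set T}) :=
  [set B in F | B :&: A != set0].
Definition star (T : finType) (F : {set {set T}}) (v : T) := [set A in F | v \in A].
Notation deg F v := #|star F v|.

Section Families.
Variable T : finType.
Implicit Types (t : nat) (F G H X Y Z : {set {set T}}) (A B C D : {set T}) (x y v : T).

Lemma intersectingP F :
  reflect {in F &, forall A B, A :&: B != set0} (intersecting F).
Proof.
apply: (iffP forallP) => [h A B AF BF | h A].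
  by have /implyP/(_ AF)/forallP/(_ B)/implyP/(_ BF) := h A.
by apply/implyP => AF; apply/forallP => B; apply/implyP => BF; exact: h.
Qed.

Lemma intersectingS F G : F \subset G -> intersecting G -> intersecting F.
Proof.
move=> /subsetP FG /intersectingP h; apply/intersectingP => A B /FG AG /FG BG.
exact: h.
Qed.

Lemma interP A B : reflect (exists2 x, x \in A & x \in B) (A :&: B != set0).
Proof.
by apply: (iffP (set0Pn _)) => [[x /setIP[]] | [x xA xB]]; exists x => //; rewrite inE xA.
Qed.

Definition intfams F t :=
  [set G : {set {set T}} | [&& G \subset F, #|G| == t & intersecting G]].

Lemma int_countE F t : int_count F t = #|intfams F t|.
Proof. by []. Qed.

Lemma int_count_bin F t : int_count F t <= 'C(#|F|, t).
Proof.
rewrite -cards_draws; apply: subset_leq_card; apply/subsetP => G.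
by rewrite !inE => /and3P[-> ->].
Qed.

Lemma int_count_intersecting F t : intersecting F -> int_count F t = 'C(#|F|, t).
Proof.
move=> hF; rewrite -cards_draws; apply: eq_card => G; rewrite !inE.
case GF: (G \subset F) => //=.
by rewrite (intersectingS GF hF) andbT.
Qed.

Lemma intfamsS F F' t : F \subset F' -> intfams F t \subset intfams F' t.
Proof.
move=> FF; apply/subsetP => G; rewrite !inE => /and3P[GF -> ->].
by rewrite (subset_trans GF FF).
Qed.

Lemma int_countS F F' t : F \subset F' -> int_count F t <= int_count F' t.
Proof. by move=> FF; apply: subset_leq_card; apply: intfamsS. Qed.

Lemma int_count0 F : int_count F 0 = 1.
Proof.
rewrite -(cards1 (set0 : {set {set T}})); apply: eq_card => G; rewrite !inE.
apply/and3P/eqP => [[_ /eqP/cards0_eq ->]//|->]; split; rewrite ?sub0set ?cards0 //.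
by apply/intersectingP => A B; rewrite inE.
Qed.

Lemma meets_sub F A : meets F A \subset F.
Proof. by apply/subsetP => B; rewrite inE => /andP[]. Qed.


Lemma starS F F' v : F \subset F' -> star F v \subset star F' v.
Proof. by move=> /subsetP h; apply/subsetP => B; rewrite !inE => /andP[/h -> ->]. Qed.


Lemma star_intersecting F v : intersecting (star F v).
Proof.
apply/intersectingP => A B; rewrite !inE => /andP[_ vA] /andP[_ vB].
by apply/interP; exists v.
Qed.

Lemma star_meets F A v : v \in A -> star F v \subset meets F A.
Proof.
move=> vA; apply/subsetP => B; rewrite !inE => /andP[-> vB] /=.
by apply/interP; exists v.
Qed.

Lemma intersectingU1 A G :
  intersecting (A |: G) = [&& A != set0, [forall B in G, B :&: A != set0] & intersecting G].
Proof.
apply/intersectingP/and3P => [h|[A0 /forall_inP hA /intersectingP hG] B C].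
  split.
  - by have := h A A; rewrite setIid; apply; rewrite setU11.
  - by apply/forall_inP => B BG; apply: h; rewrite ?setU11 // setU1r.
  - by apply/intersectingP => B C BG CG; apply: h; rewrite setU1r.
case/setU1P => [->|BG]; case/setU1P => [->|CG].
- by rewrite setIid.
- by rewrite setIC; apply: hA.
- exact: hA.
- exact: hG.
Qed.

(** The families through [A] correspond to the intersecting families of sets that
    meet [A]. *)
Lemma int_countU1 F A t : A \notin F -> A != set0 ->
  int_count (A |: F) t.+1 = int_count F t.+1 + int_count (meets F A) t.
Proof.
move=> AF A0.
rewrite int_countE -(cardsID [set G : {set {set T}} | A \in G]) addnC; congr (_ + _).
  rewrite int_countE; apply: eq_card => G; rewrite !inE.
  case AG: (A \in G) => /=.
    apply/esym/negbTE; apply: contra AF => /and3P[/subsetP h _ _]; exact: h.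
  congr andb; apply/subsetP/subsetP => h B BG.
    by have := h _ BG; rewrite !inE => /orP[/eqP BA|//]; rewrite BA AG in BG.
  by rewrite setU1r // h.
rewrite int_countE.
have inj : {in intfams (meets F A) t &, injective (fun G => A |: G)}.
  have hA G : G \in intfams (meets F A) t -> A \notin G.
    rewrite inE => /and3P[/subsetP GF _ _]; apply: contra AF => /GF.
    by rewrite inE => /andP[].
  by move=> G H /hA hG /hA hH /= e; rewrite -(setU1K hG) -(setU1K hH) e.
rewrite -(card_in_imset inj); apply: eq_card => G; apply/idP/imsetP.
  rewrite !inE => /andP[/and3P[GF Gt Gi] AG].
  exists (G :\ A); last by rewrite setD1K.
  move: Gi; rewrite -{1}(setD1K AG) intersectingU1 => /and3P[_ /forall_inP hA hG].
  rewrite inE hG andbT; apply/andP; split.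
    apply/subsetP => B BG; rewrite inE hA // andbT.
    move: BG; rewrite !inE => /andP[BA BG]; move/subsetP: GF => /(_ _ BG).
    by rewrite !inE (negbTE BA).
  by move: Gt; rewrite (cardsD1 A) AG.
case=> H; rewrite !inE => /and3P[/subsetP HF /eqP Ht Hi ->].
have AH : A \notin H by apply: contra AF => /HF; rewrite inE => /andP[].
rewrite setU11 andbT cardsU1 AH Ht eqxx intersectingU1 A0 Hi /= andbT.
apply/andP; split.
  apply/subsetP => B /setU1P[->|/HF]; rewrite ?setU11 // inE => /andP[BF _].
  by rewrite setU1r.
by apply/forall_inP => B /HF; rewrite inE => /andP[].
Qed.

Lemma int_count1 F : set0 \notin F -> int_count F 1 = #|F|.
Proof.
move=> F0; apply/eqP; rewrite eqn_leq; apply/andP; split.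
  by have := int_count_bin F 1; rewrite bin1.
rewrite int_countE; apply: (@leq_card_imset_inj _ _ (fun A => [set A])).
  by move=> A B _ _ /set1_inj.
move=> A AF; rewrite inE sub1set AF cards1 eqxx /=.
apply/intersectingP => B C /set1P-> /set1P->; rewrite setIid.
by apply: contraNneq F0 => <-.
Qed.

(** Trading [A] for [A']: an intersecting family through [A] lives on the sets
    that meet [A], whereas every family on the star of a point of [A'] can be
    completed by [A']. *)
Lemma int_count_swap F A A' v t : A \in F -> A' \notin F -> A != set0 -> v \in A' ->
  #|meets (F :\ A) A| <= deg (F :\ A) v ->
  int_count F t <= int_count (A' |: (F :\ A)) t.
Proof.
move=> AF A'F A0 vA' h; case: t => [|t]; first by rewrite !int_count0.
have A'0 : A' != set0 by apply/set0Pn; exists v.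
rewrite -{1}(setD1K AF) !int_countU1 ?setD11 //; last by rewrite inE (negbTE A'F) andbF.
rewrite leq_add2l; apply: leq_trans (int_count_bin _ _) _.
apply: leq_trans (leq_bin2l _ h) _.
by rewrite -(int_count_intersecting _ (star_intersecting _ _)) int_countS // star_meets.
Qed.

(** Bounds the families of which the few members [H] are known, all others lying in
    the small family [X] of sets compatible with [H]. *)
Lemma card_squeezed H X t :
  #|[set G : {set {set T}} | [&& H \subset G, G :\: H \subset X & #|G| == t]]|
    <= if #|H| <= t then 'C(#|X|, t - #|H|) else 0.
Proof.
case: ifP => ht; last first.
  rewrite leqn0 cards_eq0; apply/eqP/setP => G; rewrite !inE.
  apply/negbTE; apply/and3P => -[/subset_leq_card h _ /eqP e]; move: ht h; rewrite e => -> //.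
rewrite -cards_draws; apply: (@leq_card_imset_inj _ _ (fun G => G :\: H)).
  move=> G G'; rewrite !inE => /and3P[hG _ _] /and3P[hG' _ _] e.
  by rewrite -(setID G H) -(setID G' H) e (setIidPr hG) (setIidPr hG').
move=> G; rewrite !inE => /and3P[hG -> /eqP <-] /=.
by rewrite cardsD (setIidPr hG).
Qed.

End Families.

Lemma int_count_imset (T U : finType) (f : T -> U) (F : {set {set T}}) (F' : {set {set U}}) (t : nat) :
  injective f -> {in F, forall A : {set T}, f @: A \in F'} -> int_count F t <= int_count F' t.
Proof.
move=> finj h; have Finj := imset_inj finj.
rewrite int_countE; apply: (@leq_card_imset_inj _ _ (fun G : {set {set T}} => [set f @: (A : {set T}) | A in G])).
  by move=> G H _ _; apply: imset_inj.
move=> G; rewrite !inE => /and3P[/subsetP GF /eqP Gt /intersectingP Gi].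
rewrite card_imset // Gt eqxx /=; apply/andP; split.
  by apply/subsetP => B /imsetP[A /GF AF ->]; apply: h.
apply/intersectingP => B C /imsetP[A AG ->] /imsetP[A' A'G ->].
have /interP[x xA xA'] := Gi _ _ AG A'G.
by apply/interP; exists (f x); apply: imset_f.
Qed.

(** * Uniform families *)

Lemma subset_of_card (T : finType) (A : {set T}) a : a <= #|A| -> exists2 B : {set T}, B \subset A & #|B| = a.
Proof.
move=> h; have : 0 < #|[set B : {set T} | (B \subset A) && (#|B| == a)]|.
  by rewrite cards_draws bin_gt0.
by rewrite card_gt0 => /set0Pn[B]; rewrite inE => /andP[BA /eqP Ba]; exists B.
Qed.

Section Uniform.
Variable T : finType.
Implicit Types (k : nat) (F G X Y : {set {set T}}) (A B C J Z P : {set T}) (x y v : T).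

Definition kfam k := [set A : {set T} | #|A| == k].

Lemma card_trace k J Z : J \subset Z -> #|J| <= k ->
  #|[set A in kfam k | A :&: Z == J]| = 'C(#|T| - #|Z|, k - #|J|).
Proof.
move=> JZ Jk.
have -> : #|T| - #|Z| = #|~: Z| by have := cardsC Z; lia.
rewrite -cards_draws.
have inj : {in [set A : {set T} | (A \subset ~: Z) && (#|A| == k - #|J|)] &, injective (fun A => J :|: A)}.
  move=> A B; rewrite !inE => /andP[AZ _] /andP[BZ _] e.
  have h C : C \subset ~: Z -> (J :|: C) :\: Z = C.
    move=> CZ; rewrite setDUl (_ : J :\: Z = set0) ?set0U; last by apply/eqP; rewrite setD_eq0.
    by apply/setDidPl; rewrite disjoints_subset.
  by rewrite -(h A) // e h.
rewrite -(card_in_imset inj); apply: eq_card => A; apply/idP/imsetP.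
  rewrite !inE => /andP[/eqP Ak /eqP AZ]; exists (A :\: Z); last by rewrite -AZ setID.
  rewrite !inE -AZ -Ak cardsD setDE subsetIr /= ; apply/eqP; congr (_ - _).
case=> C; rewrite !inE => /andP[CZ /eqP Ck] ->.
have d : J :&: C = set0.
  apply/eqP; rewrite -subset0; apply/subsetP => x; rewrite !inE => /andP[xJ xC].
  by have := subsetP CZ _ xC; rewrite inE (subsetP JZ).
rewrite cardsU d cards0 subn0 Ck subnKC // eqxx /=.
rewrite setIUl (setIidPl JZ) (_ : C :&: Z = set0) ?setU0 ?eqxx //.
by apply/eqP; rewrite setI_eq0 disjoints_subset.
Qed.

Lemma card_containing k J :
  #|[set A in kfam k | J \subset A]| <= 'C(#|T| - #|J|, k - #|J|).
Proof.
case: (leqP #|J| k) => Jk.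
  rewrite -(card_trace (subxx J) Jk); apply: subset_leq_card; apply/subsetP => A.
  by rewrite !inE => /andP[-> /setIidPr ->] /=.
rewrite (_ : [set A in _ | _] = set0) ?cards0 //; apply/setP => A; rewrite !inE.
by apply/negbTE; apply/andP => -[/eqP e /subset_leq_card]; rewrite e leqNgt Jk.
Qed.

(** Having two points in prescribed sets of bounded size cuts the order of magnitude
    to [n ^ (k - 2)]; the set for the second point may depend on the first one. *)
Lemma card_hit2 k F P (R : T -> {set T}) r : F \subset kfam k ->
  (forall a, #|R a| <= r) ->
  {in F, forall A : {set T}, exists a b, [/\ a \in P, b \in R a, a != b, a \in A & b \in A]} ->
  #|F| <= #|P| * r * 'C(#|T| - 2, k - 2).
Proof.
move=> Fk Rr h.
apply: (@leq_trans #|\bigcup_(a in P) \bigcup_(b in R a | a != b)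
     [set A in kfam k | [set a; b] \subset A]|).
  apply: subset_leq_card; apply/subsetP => A AF.
  have [a [b [aP bR ab aA bA]]] := h _ AF.
  apply/bigcupP; exists a => //; apply/bigcupP; exists b; first by rewrite bR.
  by rewrite inE (subsetP Fk) // subUset !sub1set aA.
apply: leq_trans (card_bigcup_le _ _) _.
rewrite -mulnA -sum_nat_const; apply: leq_sum => a _.
apply: leq_trans (card_bigcup_le _ _) _.
apply: (@leq_trans (\sum_(b in R a) 'C(#|T| - 2, k - 2))); last first.
  by rewrite sum_nat_const leq_mul2r Rr orbT.
rewrite big_mkcondr; apply: leq_sum => b _; case: ifP => // ab.
have := card_containing k [set a; b]; by rewrite cards2 ab.
Qed.

Lemma card_hit3 k F P (R : T -> {set T}) (S : T -> T -> {set T}) r s : F \subset kfam k ->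
  (forall a, #|R a| <= r) -> (forall a b, #|S a b| <= s) ->
  {in F, forall A : {set T}, exists a b c,
     [/\ [/\ a \in P, b \in R a & c \in S a b], [/\ a != b, a != c & b != c]
       & [/\ a \in A, b \in A & c \in A]]} ->
  #|F| <= #|P| * r * s * 'C(#|T| - 3, k - 3).
Proof.
move=> Fk Rr Ss h.
apply: (@leq_trans #|\bigcup_(a in P) \bigcup_(b in R a)
   \bigcup_(c in S a b | [&& a != b, a != c & b != c])
     [set A in kfam k | [set a; b; c] \subset A]|).
  apply: subset_leq_card; apply/subsetP => A AF.
  have [a [b [c [[aP bR cS] [ab ac bc] [aA bA cA]]]]] := h _ AF.
  apply/bigcupP; exists a => //; apply/bigcupP; exists b => //.
  apply/bigcupP; exists c; first by rewrite cS ab ac.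
  by rewrite inE (subsetP Fk) // !subUset !sub1set aA bA.
apply: leq_trans (card_bigcup_le _ _) _.
rewrite -!mulnA -sum_nat_const; apply: leq_sum => a _.
apply: leq_trans (card_bigcup_le _ _) _.
apply: (@leq_trans (\sum_(b in R a) (s * 'C(#|T| - 3, k - 3)))); last first.
  by rewrite sum_nat_const leq_mul2r Rr orbT.
apply: leq_sum => b _.
apply: leq_trans (card_bigcup_le _ _) _.
apply: (@leq_trans (\sum_(c in S a b) 'C(#|T| - 3, k - 3))); last first.
  by rewrite sum_nat_const leq_mul2r Ss orbT.
rewrite big_mkcondr; apply: leq_sum => c _; case: ifP => // /and3P[ab ac bc].
have := card_containing k [set a; b; c].
rewrite -setUA cardsU1 !inE negb_or ab ac cards2 bc //.
Qed.

Definition touching k (X : {set T}) := meets (kfam k) X.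

Lemma card_touching k (X : {set T}) : #|touching k X| = 'C(#|T|, k) - 'C(#|T| - #|X|, k).
Proof.
have h := card_draws T k.
have e := @card_trace k set0 X (sub0set _); rewrite cards0 subn0 in e.
rewrite -(e isT) -h -(cardsID [set A : {set T} | A :&: X != set0] [set A : {set T} | #|A| == k]).
have -> : [set A in kfam k | A :&: X == set0] =
          [set A : {set T} | #|A| == k] :\: [set A : {set T} | A :&: X != set0].
  by apply/setP => A; rewrite !inE negbK andbC.
by rewrite addnK; apply: eq_card => A; rewrite !inE.
Qed.

Lemma card_kstar k v : 0 < k -> #|star (kfam k) v| = 'C(#|T| - 1, k - 1).
Proof.
move=> k0; have := @card_trace k [set v] [set v] (subxx _); rewrite cards1 => <- //.
apply: eq_card => A; rewrite !inE; congr andb; apply/idP/eqP => [vA|e].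
  by apply/setIidPr; rewrite sub1set.
by have := set11 v; rewrite -e inE => /andP[].
Qed.

Lemma card_touching_le k (X : {set T}) : 0 < k -> #|touching k X| <= #|X| * 'C(#|T| - 1, k - 1).
Proof.
move=> k0; rewrite -sum_nat_const.
apply: (@leq_trans #|\bigcup_(v in X) star (kfam k) v|).
  apply: subset_leq_card; apply/subsetP => A; rewrite inE => /andP[Ak /interP[x xA xX]].
  by apply/bigcupP; exists x => //; rewrite inE Ak.
apply: leq_trans (card_bigcup_le _ _) _.
by apply: leq_sum => v _; rewrite card_kstar.
Qed.

Lemma sum_deg k F : F \subset kfam k -> \sum_v deg F v = k * #|F|.
Proof.
move=> Fk.
transitivity (\sum_v \sum_(A in F) (v \in A : nat)).
  apply: eq_bigr => v _; rewrite -sum1_card big_mkcond [RHS]big_mkcond /=.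
  by apply: eq_bigr => A _; rewrite inE; case: (A \in F); case: (v \in A).
rewrite exchange_big /= mulnC -sum_nat_const; apply: eq_bigr => A AF.
have /eqP <- : #|A| == k by have := subsetP Fk _ AF; rewrite inE.
by rewrite -sum1_card [RHS]big_mkcond; apply: eq_bigr => v _; case: (v \in A).
Qed.

(** The source of all relabellings: sequences that list the sets to be matched. *)
Lemma extend_inj (s1 s2 : seq T) : uniq s1 -> uniq s2 -> size s1 = size s2 ->
  exists2 f : T -> T, injective f & map f s1 = s2.
Proof.
move=> u1 u2 es.
pose c (s : seq T) := s ++ [seq x <- enum T | x \notin s].
have cu s : uniq s -> uniq (c s).
  move=> us; rewrite cat_uniq us filter_uniq ?enum_uniq // andbT.
  by apply/hasPn => x; rewrite mem_filter => /andP[].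
have cm s x : x \in c s.
  by rewrite mem_cat mem_filter mem_enum andbT; case: (x \in s).
have cs s : uniq s -> size (c s) = #|T|.
  move=> us; rewrite cardT; apply: perm_size; apply: uniq_perm; rewrite ?cu ?enum_uniq //.
  by move=> x; rewrite cm mem_enum.
exists (fun x => nth x (c s2) (index x (c s1))).
  move=> x y e; have ix z : index z (c s1) < size (c s2).
    by rewrite (cs _ u2) -(cs _ u1) index_mem cm.
  rewrite (set_nth_default x y) // in e.
  by have /eqP := e; rewrite nth_uniq ?cu // => /eqP; apply: index_inj.
case: s1 u1 es => [|x0 s1] u1 es; first by case: s2 u2 es.
apply: (@eq_from_nth _ x0); rewrite size_map // => i ilt.
rewrite (nth_map x0) //; set x := nth x0 (x0 :: s1) i; rewrite -[LHS]/(nth x (c s2) (index x (c (x0 :: s1)))).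
have -> : index x (c (x0 :: s1)) = i.
  by rewrite index_cat mem_nth // index_uniq.
by rewrite nth_cat -es ilt; apply: set_nth_default; rewrite -es.
Qed.

End Uniform.

(** * Initial segments of the lexicographic order *)

Lemma lex_ltP n (A B : {set 'I_n}) :
  reflect (exists i : 'I_n, [/\ i \in A, i \notin B & forall j : 'I_n, j < i -> (j \in A) = (j \in B)])
          (lex_lt A B).
Proof.
apply: (iffP existsP) => [[i /and3P[iS /forall_inP h iA]]|[i [iA iB h]]]; exists i.
  move: iS; rewrite !inE iA /= andbT orbF => iB; split=> // j ji.
  apply/idP/idP => [jA|jB]; apply: contraTT ji => jn; rewrite -leqNgt; apply: h.
    by rewrite !inE jA jn.
  by rewrite !inE jB jn orbT.
apply/and3P; split; rewrite ?inE ?iA ?iB //.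
apply/forall_inP => j; rewrite leqNgt => jS; apply/negP => /h e.
by move: jS; rewrite !inE e; case: (j \in B).
Qed.

Lemma lex_le_trans n : transitive (@lex_le n).
Proof.
move=> B A C; rewrite /lex_le => /orP[/eqP->//|/lex_ltP[i [iA iB hi]]].
case/orP => [/eqP<-|/lex_ltP[j [jB jC hj]]]; apply/orP; right; apply/lex_ltP.
  by exists i.
case: (ltngtP i j) => ij.
- by exists i; split=> //; [rewrite -hj|move=> a ai; rewrite hi // hj // (ltn_trans ai)].
- by exists j; split=> //; [rewrite hi|move=> a aj; rewrite hi ?hj // (ltn_trans aj)].
- by move/val_inj: ij jB => <-; rewrite (negbTE iB).
Qed.

Lemma lex_le_anti n : antisymmetric (@lex_le n).
Proof.
move=> A B; rewrite /lex_le => /andP[/orP[/eqP->//|/lex_ltP[i [iA iB hi]]]].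
case/orP => [/eqP->//|/lex_ltP[j [jB jA hj]]].
case: (ltngtP i j) => ij.
- by rewrite hj ?iA // in iB.
- by rewrite hi ?jB // in jA.
- by move/val_inj: ij jB => <-; rewrite (negbTE iB).
Qed.

Lemma lex_le_total n : total (@lex_le n).
Proof.
move=> A B; rewrite /lex_le; case: (eqVneq A B) => [->//|AB].
have [i iS]: exists i, i \in symdiff A B.
  apply/existsP; apply: contra_neqT AB; rewrite negb_exists => /forallP h.
  apply/setP => x; have := h x; rewrite !inE.
  by case: (x \in A); case: (x \in B).
case: (@arg_minnP _ i (mem (symdiff A B)) val iS) => j jS jmin.
move: (jS); rewrite /symdiff !inE => /orP[] /andP[jn jy]; apply/orP; [left|right; apply/orP; right];
  apply/existsP; exists j.
  by apply/and3P; split=> //; apply/forall_inP.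
have e : symdiff B A = symdiff A B by rewrite /symdiff setUC.
by rewrite e; apply/and3P; split=> //; apply/forall_inP.
Qed.

(** The sorted list splits into the members of [Y] followed by the other sets. *)
Lemma lex_family_downset n k (Y : {set {set 'I_n}}) : Y \subset kfam 'I_n k ->
  (forall A B, A \in kfam 'I_n k -> B \in Y -> lex_lt A B -> A \in Y) ->
  lex_family n k #|Y| = Y.
Proof.
move=> /subsetP Yk down; rewrite /lex_family.
set s := sort _ _.
have us : uniq s by rewrite sort_uniq enum_uniq.
have ms A : (A \in s) = (A \in kfam 'I_n k) by rewrite mem_sort mem_enum.
have ss : sorted (@lex_le n) s by apply: sort_sorted; apply: lex_le_total.
have e : s = [seq A <- s | A \in Y] ++ [seq A <- s | A \notin Y].
  apply: (sorted_eq (@lex_le_trans n) (@lex_le_anti n)) => //; last first.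
    by rewrite perm_sym; apply/permPl; apply: perm_filterC.
  rewrite sorted_pairwise; last exact: lex_le_trans.
  rewrite pairwise_cat -!sorted_pairwise; try exact: lex_le_trans.
  rewrite !(sorted_filter (@lex_le_trans n)) // !andbT.
  apply/allrelP => B A; rewrite !mem_filter => /andP[BY _] /andP[AY As].
  have /orP[//|] := lex_le_total B A; rewrite {1}/lex_le => /orP[/eqP AB|lAB].
    by rewrite AB BY in AY.
  by rewrite (down _ _ _ BY lAB) -?ms in AY.
have cY : size [seq A <- s | A \in Y] = #|Y|.
  rewrite cardE; apply: perm_size; apply: uniq_perm; rewrite ?enum_uniq ?(filter_uniq _ us) //.
  move=> A; rewrite mem_filter mem_enum ms; case AY: (A \in Y) => //=; exact: Yk.
apply/setP => A; rewrite inE e take_size_cat // mem_filter ms.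
by case AY: (A \in Y) => //=; apply: Yk.
Qed.

Lemma card_ord_lt n a : a <= n -> #|[set i : 'I_n | i < a]| = a.
Proof.
move=> an; rewrite cardE -(size_map val) -[RHS](size_iota 0).
apply: perm_size; apply: uniq_perm; rewrite ?iota_uniq ?(map_inj_uniq val_inj) ?enum_uniq //.
move=> x; rewrite mem_iota add0n /=; apply/mapP/idP => [[i]|xa].
  by rewrite mem_enum inE => h ->.
by exists (Ordinal (leq_trans xa an)); rewrite // mem_enum inE.
Qed.

Lemma card_ord_itv n a b : a <= b -> b <= n -> #|[set i : 'I_n | a <= i < b]| = b - a.
Proof.
move=> ab bn; have := cardsID [set i : 'I_n | i < a] [set i : 'I_n | i < b].
rewrite card_ord_lt // (_ : _ :&: _ = [set i : 'I_n | i < a]); last first.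
  by apply/setP => i; rewrite !inE; lia.
rewrite card_ord_lt ?(leq_trans ab) // (_ : _ :\: _ = [set i : 'I_n | a <= i < b]); first by lia.
by apply/setP => i; rewrite !inE; lia.
Qed.

(** With [L] the first [l] points and [K] the next [k.-1] ones, the sets that meet
    [L] come first, then the sets [x |: K] in the order of [x]. *)
Lemma lex_family_structure n k l r : 0 < k -> l + k <= n -> r <= n - l - k + 1 ->
  exists (L K : {set 'I_n}) (R : {set {set 'I_n}}),
   [/\ #|L| = l, #|K| = k.-1 & K :&: L = set0] /\
   [/\ lex_family n k ('C(n, k) - 'C(n - l, k) + r) = touching k L :|: R,
     #|R| = r, R \subset kfam 'I_n k & {in R, forall A : {set 'I_n}, K \subset A /\ A :&: L = set0}].
Proof.
move=> k0 lkn rn.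
pose L := [set i : 'I_n | i < l].
pose K := [set i : 'I_n | l <= i < l + k.-1].
pose X := [set i : 'I_n | l + k.-1 <= i < l + k.-1 + r].
pose R := [set x |: K | x in X].
have cL : #|L| = l by apply: card_ord_lt; lia.
have cK : #|K| = k.-1 by rewrite card_ord_itv; lia.
have cX : #|X| = r by rewrite card_ord_itv; lia.
have XK x : x \in X -> x \notin K by rewrite !inE; lia.
have cR : #|R| = r.
  rewrite -cX; apply: card_in_imset => x y xX yX e.
  have: x \in y |: K by rewrite -e setU11.
  by rewrite in_setU1 (negbTE (XK _ xX)) orbF => /eqP.
have Rk : R \subset kfam 'I_n k.
  apply/subsetP => A /imsetP[x xX ->]; rewrite inE cardsU1 XK // cK; apply/eqP; lia.
have KL : K :&: L = set0 by apply/setP => i; rewrite !inE; lia.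
have RL (A : {set 'I_n}) : A \in R -> A :&: L = set0.
  case/imsetP => x xX ->; rewrite setIUl KL setU0; apply/setP => i.
  by move: xX; rewrite !inE; case: eqP => [->|]; lia.
exists L, K, R; split=> //; split=> //; last first.
  by move=> A AR; split; [case/imsetP: AR => x _ ->; apply: subsetUr | apply: RL].
have RT : touching k L :&: R = set0.
  apply/eqP; rewrite -subset0; apply/subsetP => A; rewrite inE => /andP[].
  by rewrite inE => /andP[_ AL] /RL e; rewrite e eqxx in AL.
have -> : 'C(n, k) - 'C(n - l, k) + r = #|touching k L :|: R|.
  by rewrite cardsU RT cards0 subn0 card_touching card_ord cL cR.
apply: lex_family_downset.
  by rewrite subUset Rk andbT; apply: meets_sub.
move=> A B Ak BY /lex_ltP[i [iA iB hi]].
rewrite !inE; move: Ak; rewrite inE => Ak; rewrite Ak /=.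
case: (boolP (A :&: L == set0)) => //= /eqP AL; have nAL x : x \in A -> l <= x.
  move=> xA; have : x \notin A :&: L by rewrite AL inE.
  by rewrite !inE xA /= -leqNgt.
case/setUP: BY => [|BR].
  rewrite inE => /andP[_ /interP[x xB]]; rewrite inE => xl.
  have xi : x < i by apply: leq_trans xl (nAL _ iA).
  have xA : x \in A by rewrite hi.
  by have := nAL _ xA; rewrite leqNgt xl.
case/imsetP: BR => y yX eB.
have KA : K \subset A.
  apply/subsetP => x xK; rewrite hi ?eB ?setU1r //.
  rewrite ltnNge; apply: contra iB => ix; rewrite eB setU1r // inE nAL //=.
  by apply: leq_ltn_trans ix _; move: xK; rewrite inE => /andP[].
have iK : i \notin K by apply: contra iB => iK; rewrite eB setU1r.
have iy : i < y.
  rewrite ltnNge leq_eqVlt negb_or; apply/andP; split.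
    by apply: contra iB => /eqP/val_inj <-; rewrite eB setU11.
  apply/negP => yi; have yA : y \in A by rewrite hi // eB setU11.
  have : #|i |: (y |: K)| <= #|A|.
    by apply: subset_leq_card; rewrite !subUset !sub1set iA yA KA.
  rewrite (eqP Ak) !cardsU1 XK // !in_setU1 (negbTE iK) orbF cK.
  have -> /= : i != y by apply: contraTneq yi => ->; rewrite ltnn.
  lia.
apply/imsetP; exists i.
  by move: iK (nAL _ iA) yX; rewrite !inE; lia.
apply/eqP; rewrite eq_sym eqEcard subUset sub1set iA KA /= (eqP Ak) cardsU1 iK cK; lia.
Qed.

(** * Families with all stars of a set and few other members *)

Section Transversals.
Variable T : finType.
Implicit Types (k t s : nat) (F G H X Y S R : {set {set T}}) (A B C D J Z P L K : {set T}) (x y v : T).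

Definition hitting S H := [set B in S | [forall A in H, B :&: A != set0]].

Lemma hittingP S H B :
  reflect (B \in S /\ {in H, forall A, B :&: A != set0}) (B \in hitting S H).
Proof. by rewrite inE; apply: (iffP andP) => -[h1 h2]; split=> //; apply/forall_inP. Qed.

(** The intersecting families are sorted by their part [H] in [R]. *)
Lemma int_count_split S R t : S :&: R = set0 ->
  int_count (S :|: R) t = \sum_(H in powerset R | (#|H| <= t) && intersecting H)
     int_count (hitting S H) (t - #|H|).
Proof.
move=> SR; rewrite int_countE -sum1_card.
have nSR A : A \in S -> A \notin R.
  move=> AS; apply/negP => AR; have : A \in S :&: R by rewrite inE AS.
  by rewrite SR inE.
rewrite (partition_big (fun G => G :&: R)
   (fun H => (H \in powerset R) && ((#|H| <= t) && intersecting H))); last first.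
  move=> G; rewrite inE => /and3P[_ /eqP <- Gi]; rewrite powersetE subsetIr /=.
  by rewrite subset_leq_card ?subsetIl //= (intersectingS (subsetIl _ _) Gi).
apply: eq_bigr => H /and3P[]; rewrite powersetE => HR Ht /intersectingP Hi.
rewrite sum1_card int_countE.
have inj : {in intfams (hitting S H) (t - #|H|) &, injective (fun G => G :|: H)}.
  have h G : G \in intfams (hitting S H) (t - #|H|) -> (G :|: H) :\: R = G.
    rewrite inE => /and3P[/subsetP GS _ _]; apply/setP => A; rewrite !inE.
    case AG: (A \in G); first by have /hittingP[/nSR -> _] := GS _ AG.
    by case AH: (A \in H); rewrite ?andbF // (subsetP HR).
  by move=> G G' /h e /h e' E; rewrite -e E e'.
rewrite -(card_in_imset inj); apply: eq_card => G; apply/idP/imsetP.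
  rewrite unfold_in inE => /andP[/and3P[GSR Gt /intersectingP Gi] /eqP eH].
  exists (G :\: R); last by rewrite -eH setUC setID.
  rewrite inE; apply/and3P; split.
  - apply/subsetP => A /setDP[AG AR]; apply/hittingP; split.
      by have := subsetP GSR _ AG; rewrite inE (negbTE AR) orbF.
    by move=> B; rewrite -eH => /setIP[BG _]; apply: Gi.
  - by rewrite -(eqP Gt) cardsD eH.
  - by apply: (intersectingS (subsetDl _ _)); apply/intersectingP.
case=> G'; rewrite inE => /and3P[/subsetP GS /eqP Gt /intersectingP Gi] ->.
rewrite unfold_in inE.
have GR A : A \in G' -> A \notin R by move=> /GS /hittingP[/nSR].
have d : G' :&: H = set0.
  apply/eqP; rewrite -subset0; apply/subsetP => A /setIP[/GR AR AH].
  by rewrite (subsetP HR) in AR.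
apply/andP; split; last first.
  apply/eqP/setP => A; rewrite !inE.
  case AG: (A \in G') => /=.
    rewrite (negbTE (GR _ AG)); apply/esym/negbTE/negP => AH.
    by have : A \in G' :&: H; [rewrite inE AG | rewrite d inE].
  by case AH: (A \in H) => //=; rewrite (subsetP HR).
apply/and3P; split.
- apply/subsetP => A /setUP[/GS/hittingP[AS _]|/(subsetP HR) AR]; by rewrite inE ?AS ?AR ?orbT.
- by rewrite cardsU d cards0 subn0 Gt subnK.
- apply/intersectingP => A B /setUP[AG|AH] /setUP[BG|BH].
  + exact: Gi.
  + by have /hittingP[_] := GS _ AG; apply.
  + by rewrite setIC; have /hittingP[_] := GS _ BG; apply.
  + exact: Hi.
Qed.

(** A bijection from [R] to [R'] pairs the parts [H], and since [R'] is
    intersecting no part is lost on the right-hand side. *)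
Lemma int_count_split_le S R S' R' t : S :&: R = set0 -> S' :&: R' = set0 ->
  #|R| = #|R'| -> intersecting R' ->
  (forall H H' s, H \subset R -> H' \subset R' -> #|H| = #|H'| -> intersecting H ->
     int_count (hitting S H) s <= int_count (hitting S' H') s) ->
  int_count (S :|: R) t <= int_count (S' :|: R') t.
Proof.
move=> SR SR' eR R'i h.
have [f finj fmap] : exists2 f : {set T} -> {set T}, injective f & map f (enum R) = enum R'.
  by apply: extend_inj; rewrite ?enum_uniq // -!cardE.
have fR A : A \in R -> f A \in R' by move=> AR; rewrite -mem_enum -fmap map_f // mem_enum.
rewrite !int_count_split //.
pose b H := if (#|H| <= t) && intersecting H then int_count (hitting S' H) (t - #|H|) else 0.
have sub H : H \subset R -> f @: H \subset R'.
  by move=> HR; apply/subsetP => _ /imsetP[A AH ->]; rewrite fR // (subsetP HR).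
apply: (@leq_trans (\sum_(H in powerset R) b (f @: H))).
  rewrite big_mkcondr; apply: leq_sum => H; rewrite powersetE => HR.
  rewrite /b (card_imset _ finj) (intersectingS (sub _ HR) R'i) andbT.
  case: ifP => [/andP[-> Hi]|_] //; apply: h => //; first exact: sub.
  by rewrite card_imset.
rewrite -(big_imset b (h := fun H => f @: H)); last by move=> x y _ _; apply: imset_inj.
rewrite [X in _ <= X]big_mkcondr /=.
rewrite [X in X <= _]big_mkcond [X in _ <= X]big_mkcond /=; apply: leq_sum => H _.
case: ifP => // /imsetP[H']; rewrite powersetE => /sub h' ->.
by rewrite powersetE h'.
Qed.

Lemma extend_inj3 (A1 A2 A3 B1 B2 B3 : {set T}) :
  [/\ #|A1| = #|B1|, #|A2| = #|B2| & #|A3| = #|B3|] ->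
  [/\ [disjoint A1 & A2], [disjoint A1 & A3] & [disjoint A2 & A3]] ->
  [/\ [disjoint B1 & B2], [disjoint B1 & B3] & [disjoint B2 & B3]] ->
  exists2 f : T -> T, injective f & [/\ f @: A1 = B1, f @: A2 = B2 & f @: A3 = B3].
Proof.
have u (C1 C2 C3 : {set T}) : [/\ [disjoint C1 & C2], [disjoint C1 & C3] & [disjoint C2 & C3]] ->
    uniq (enum C1 ++ enum C2 ++ enum C3).
  case=> /pred0P h12 /pred0P h13 /pred0P h23; rewrite !cat_uniq !enum_uniq !andbT /=.
  apply/andP; split; apply/hasPn => x.
    rewrite mem_cat !mem_enum => /orP[] xC; apply/negP => xC1.
      by have := h12 x; rewrite /= xC1 xC.
    by have := h13 x; rewrite /= xC1 xC.
  by rewrite !mem_enum => xC; apply/negP => xC1; have := h23 x; rewrite /= xC1 xC.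
move=> [e1 e2 e3] /u uA /u uB.
have [|f finj] := extend_inj uA uB; first by rewrite !size_cat -!cardE e1 e2 e3.
have sz (A B : {set T}) : #|A| = #|B| -> size (map f (enum A)) = size (enum B).
  by rewrite size_map !cardE.
rewrite !map_cat => /eqP; rewrite eqseq_cat ?(sz _ _ e1) // => /andP[/eqP m1].
rewrite eqseq_cat ?(sz _ _ e2) // => /andP[/eqP m2 /eqP m3].
have im (A B : {set T}) : map f (enum A) = enum B -> f @: A = B.
  move=> m; apply/setP => y; rewrite -[RHS]mem_enum -m; apply/imsetP/mapP => -[x xA ->].
    by exists x; rewrite ?mem_enum.
  by exists x => //; rewrite -mem_enum.
by exists f => //; split; apply: im.
Qed.

(** Up to relabelling, a family whose members contain the same [k.-1]-set is
    determined by its size. *)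
Lemma sunflower_hitting_le k (L K L' K' : {set T}) H H' s : 0 < k ->
  #|L| = #|L'| -> #|K| = k.-1 -> #|K'| = k.-1 -> K :&: L = set0 -> K' :&: L' = set0 ->
  #|H| = #|H'| -> H \subset kfam T k -> H' \subset kfam T k ->
  {in H, forall A, K \subset A /\ A :&: L = set0} ->
  {in H', forall A, K' \subset A /\ A :&: L' = set0} ->
  int_count (hitting (touching k L) H) s <= int_count (hitting (touching k L') H') s.
Proof.
move=> k0 eL cK cK' KL KL' eH Hk Hk' hH hH'.
pose ext (K0 : {set T}) (H0 : {set {set T}}) := [set x | (x \notin K0) && (x |: K0 \in H0)].
have extI (K0 : {set T}) (H0 : {set {set T}}) x : x \in ext K0 H0 -> x \notin K0 /\ x |: K0 \in H0.
  by rewrite inE => /andP.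
have ext_im (K0 L0 : {set T}) (H0 : {set {set T}}) : #|K0| = k.-1 -> H0 \subset kfam T k ->
   {in H0, forall A, K0 \subset A /\ A :&: L0 = set0} ->
   (fun x => x |: K0) @: ext K0 H0 = H0.
  move=> c0 Hk0 h0; apply/setP => A; apply/imsetP/idP => [[x /extI[_ xH] ->//]|AH].
  have [KA _] := h0 _ AH; have Ak : #|A| = k by have := subsetP Hk0 _ AH; rewrite inE => /eqP.
  have : #|A :\: K0| = 1 by rewrite cardsD (setIidPr KA) c0 Ak; lia.
  case/eqP/cards1P => x ex; have xA : x |: K0 = A.
    by rewrite -ex -[RHS](setID A K0) (setIidPr KA) setUC.
  exists x; rewrite // inE xA AH andbT.
  by have := set11 x; rewrite -ex inE => /andP[].
have ext_card (K0 L0 : {set T}) (H0 : {set {set T}}) : #|K0| = k.-1 -> H0 \subset kfam T k ->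
   {in H0, forall A, K0 \subset A /\ A :&: L0 = set0} -> #|ext K0 H0| = #|H0|.
  move=> c0 Hk0 h0; rewrite -[in RHS](ext_im K0 L0 H0) // card_in_imset //.
  move=> x y /extI[xK _] _ e; have : x \in y |: K0 by rewrite -e setU11.
  by rewrite in_setU1 (negbTE xK) orbF => /eqP.
have disj (K0 L0 : {set T}) (H0 : {set {set T}}) : K0 :&: L0 = set0 ->
   {in H0, forall A, K0 \subset A /\ A :&: L0 = set0} ->
   [/\ [disjoint L0 & K0], [disjoint L0 & ext K0 H0] & [disjoint K0 & ext K0 H0]].
  move=> KL0 h0; split; rewrite -setI_eq0.
  - by rewrite setIC KL0.
  - rewrite -subset0; apply/subsetP => x /setIP[xL /extI[_ /h0[_ e]]].
    by have : x \in (x |: K0) :&: L0; [rewrite inE setU11 | rewrite e inE].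
  - by rewrite -subset0; apply/subsetP => x /setIP[xK /extI[]]; rewrite xK.
have [|||f finj [fL fK fX]] := @extend_inj3 L K (ext K H) L' K' (ext K' H').
- by rewrite eL cK cK' (ext_card K L) // (ext_card K' L').
- exact: disj.
- exact: disj.
apply: (@int_count_imset T T f _ _ s finj) => B /hittingP[]; rewrite !inE => /andP[/eqP Bk /interP[x xB xL]] BH.
rewrite card_imset // Bk eqxx /=; apply/andP; split.
  by apply/interP; exists (f x); rewrite ?imset_f // -fL imset_f.
apply/forall_inP => A'; rewrite -(ext_im K' L' H') // => /imsetP[y]; rewrite -fX => /imsetP[z zX ->] ->.
have [_ /BH /interP[w wB wA]] := extI _ _ _ zX.
apply/interP; exists (f w); first by rewrite imset_f.
case/setU1P: wA => [->|wK]; first by rewrite setU11.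
by rewrite setU1r // -fK imset_f.
Qed.

End Transversals.

(** * Comparing the transversals of a family with those of a single set *)

Section Tools.
Variable T : finType.
Implicit Types (k t s : nat) (F G H X Y S Z P Q : {set {set T}}) (A B C D J : {set T}) (x y v : T).

Lemma card_through F A t : A \in F -> A != set0 ->
  #|[set G in intfams F t.+1 | A \in G]| = int_count (meets (F :\ A) A) t.
Proof.
move=> AF A0; have := int_countU1 t (negbT (setD11 A F)) A0; rewrite setD1K //.
rewrite int_countE -(cardsID [set G : {set {set T}} | A \in G]).
rewrite (_ : intfams F t.+1 :\: _ = intfams (F :\ A) t.+1); last first.
  apply/setP => G; rewrite !inE; case AG: (A \in G) => /=.
    apply/esym/negbTE/negP => /and3P[/subsetP /(_ _ AG)]; by rewrite setD11.
  congr andb; apply/subsetP/subsetP => h B BG; have := h _ BG; rewrite !inE; last by case/andP.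
  by move=> ->; rewrite andbT; apply: contraFneq AG => <-.
rewrite -int_countE addnC => /addnI <-; apply: eq_card => G; rewrite !inE //.
Qed.

(** Sets that meet everything may be added to any intersecting family, so only
    their number matters. *)
Lemma int_count_cone_le X Z Z' t : X :&: Z = set0 -> X :&: Z' = set0 ->
  {in Z & X :|: Z, forall A B, B :&: A != set0} ->
  {in Z' & X :|: Z', forall A B, B :&: A != set0} ->
  #|Z| <= #|Z'| -> int_count (X :|: Z) t <= int_count (X :|: Z') t.
Proof.
move En: #|Z| => n; elim: n Z Z' t En => [|n IH] Z Z' t En XZ XZ' hZ hZ' le.
  by apply: int_countS; rewrite (cards0_eq En) setU0 subsetUl.
case: t => [|t]; first by rewrite !int_count0.
have [z zZ] : exists z, z \in Z by apply/set0Pn; rewrite -card_gt0 En.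
have [z' zZ'] : exists z, z \in Z' by apply/set0Pn; rewrite -card_gt0; lia.
have step (Y : {set {set T}}) w u : w \in Y -> X :&: Y = set0 ->
   {in Y & X :|: Y, forall A B, B :&: A != set0} ->
   int_count (X :|: Y) u.+1 = int_count (X :|: (Y :\ w)) u.+1 + int_count (X :|: (Y :\ w)) u.
  move=> wY XY hY; have wX : w \notin X.
    by apply/negP => wX; have : w \in X :&: Y; [rewrite inE wX | rewrite XY inE].
  rewrite -{1}(setD1K wY) setUCA int_countU1 ?inE ?(negbTE wX) ?eqxx //; last first.
    by have := hY w w wY; rewrite setIid; apply; rewrite inE wY orbT.
  congr (_ + int_count _ _); apply/setP => B; rewrite inE.
  case BY: (B \in _) => //=; apply: hY => //.
  by move: BY; rewrite !inE => /orP[->//|/andP[_ ->]]; rewrite orbT.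
have sub (Y : {set {set T}}) w : X :&: Y = set0 -> X :&: (Y :\ w) = set0.
  by move=> XY; apply/eqP; rewrite -subset0 -XY setIS // subsetDl.
have hsub (Y : {set {set T}}) w : {in Y & X :|: Y, forall A B, B :&: A != set0} ->
    {in Y :\ w & X :|: (Y :\ w), forall A B, B :&: A != set0}.
  move=> h A B /setD1P[_ AY] BY; apply: h => //.
  by move: BY; rewrite !inE => /orP[->//|/andP[_ ->]]; rewrite orbT.
have En' : #|Z :\ z| = n by have := cardsD1 z Z; rewrite zZ En; lia.
have le' : n <= #|Z' :\ z'| by have := cardsD1 z' Z'; rewrite zZ'; lia.
rewrite (step Z z) // (step Z' z') //.
by apply: leq_add; apply: IH => //; first [exact: sub | exact: hsub].
Qed.

(** All the subfamilies of [P] are intersecting, and those not inside [Q] are new. *)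
Lemma int_count_gain Q Q' P t : Q \subset Q' -> P \subset Q' -> intersecting P ->
  int_count Q t + 'C(#|P|, t) <= int_count Q' t + 'C(#|P :&: Q|, t).
Proof.
move=> QQ' PQ' Pi; rewrite -(int_count_intersecting t Pi).
have Pi' := intersectingS (subsetIl P Q) Pi; rewrite -(int_count_intersecting t Pi').
rewrite !int_countE -cardsUI; apply: leq_add; apply: subset_leq_card.
  by rewrite subUset !intfamsS.
apply/subsetP => G; rewrite !inE => /andP[/and3P[GQ -> ->] /and3P[GP _ _]].
by rewrite subsetI GP GQ.
Qed.

Lemma card_disjoint_bigcup (I : finType) (E : {set I}) (X : I -> {set {set T}}) w :
  {in E &, forall e e', e != e' -> X e :&: X e' = set0} ->
  {in E, forall e, #|X e| = w} -> #|\bigcup_(e in E) X e| = #|E| * w.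
Proof.
move=> d hw; have := @partition_disjoint_bigcup _ I nat 0 addn (fun e => if e \in E then X e else set0) (fun=> 1).
rewrite sum1_card -big_mkcond /= => ->.
  rewrite -sum_nat_const [RHS]big_mkcond; apply: eq_bigr => e _; rewrite sum1_card.
  by case: ifP => [/hw//|_]; rewrite cards0.
move=> e e' ee'; rewrite -setI_eq0; case: ifP => eE; case: ifP => eE'; rewrite ?set0I ?setI0 //.
by rewrite d.
Qed.

(** Part of the star of [c]; fixing the whole trace on [Z] makes the size exact. *)
Definition broom k c (E Z : {set T}) : {set {set T}} :=
  \bigcup_(e in E) [set A in kfam T k | A :&: Z == [set c; e]].

Lemma broomP k c (E Z : {set T}) A :
  reflect (exists2 e, e \in E & #|A| = k /\ A :&: Z = [set c; e]) (A \in broom k c E Z).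
Proof.
apply: (iffP bigcupP) => [[e eE h]|[e eE [Ak AZ]]]; exists e => //.
  by move: h; rewrite !inE => /andP[/eqP-> /eqP->].
by rewrite !inE Ak AZ !eqxx.
Qed.

Lemma card_broom k c (E Z : {set T}) : 1 < k -> c |: E \subset Z -> c \notin E ->
  #|broom k c E Z| = #|E| * 'C(#|T| - #|Z|, k - 2).
Proof.
move=> k1 cEZ cE; apply: card_disjoint_bigcup => [e e' eE e'E ee'|e eE].
  apply/eqP; rewrite -subset0; apply/subsetP => A; rewrite !inE => /andP[/andP[_ /eqP e1] /andP[_ /eqP e2]].
  have : e \in [set c; e'] by rewrite -e2 e1 !inE eqxx orbT.
  rewrite !inE (negbTE ee') orbF => /eqP ec; by rewrite -ec eE in cE.
have ce : c != e by apply: contraNneq cE => ->.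
have c2 : #|[set c; e]| = 2 by rewrite cards2 ce.
rewrite card_trace ?c2 //; apply: subset_trans cEZ.
by rewrite subUset !sub1set setU11 setU1r.
Qed.

Lemma broom_intersecting k c (E Z : {set T}) : intersecting (broom k c E Z).
Proof.
apply/intersectingP => A B /broomP[e _ [_ eA]] /broomP[e' _ [_ eB]].
have h (C : {set T}) a : C :&: Z = [set c; a] -> c \in C.
  by move=> eC; have : c \in C :&: Z; [rewrite eC !inE eqxx | case/setIP].
by apply/interP; exists c; [apply: h eA | apply: h eB].
Qed.

End Tools.

(** Collects the error terms of [int_count_near] and [trans_numeric]. *)
Definition trans_const l p k c :=
  2 * ((l + p) * (l + p) + c + l * p * (l + p + 3 * k) + c * (l + p + 1)
       + 2 * (l + p) + 4 * (l * p * (l * p * k))) + 8.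

(** Here [C2] and [W] are both of order [n ^ (k - 2)] and differ by [O(C3)], where
    [C3] has order [n ^ (k - 3)].  The left-hand side is the bound of
    [int_count_near] times the number of exceptional sets; on the right [w] new
    sets are each added to a star of [m.+1 * W - w] sets.  The point is that [m.+1]
    stands against [m], and against [2] where [m > 1]. *)
Lemma trans_numeric l p k c C2 C3 W s M m w : 0 < C3 -> 1 < l ->
  C2 <= W + (l + p) * C3 -> trans_const l p k c * C3 <= W ->
  M = (c + l * p * (l + p + 3 * k)) * C3 ->
  m = maxn p (l - 1) ->
  w = c * (l + p + 1) * C3 ->
  c * C3 * ((l + p) * 'C(m * C2 + M, s)
     + (if (1 < s) && (1 < m) then l * p * C2 * (l * p * k * C3) * 'C(2 * C2 + M, s - 2) else 0))
  <= w * 'C(m.+1 * W - w, s).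
Proof.
move=> C3p l2 hC2 hW eM em ew.
have mlp : m <= l + p by lia.
set q := l * p * (l * p * k).
have hW' : 2 * ((l + p) * (l + p) * C3 + M + w + 2 * (l + p) * C3 + 4 * (q * C3)) + 8 <= W.
  by apply: leq_trans hW; rewrite /trans_const -/q eM ew; lia.
have mlp' : m * (l + p) * C3 <= (l + p) * (l + p) * C3 by rewrite !leq_mul2r mlp !orbT.
have eq : l * p * C2 * (l * p * k * C3) = (q * C3) * C2 by rewrite /q; lia.
rewrite {}eq.
have eqw : w = c * C3 * (l + p).+1 by rewrite ew; lia.
clear hW eM em ew; set QC := q * C3 in hW' *; set V := (l + p) * C3 in hC2.
have hW2 : 2 * (m * V + M + w + 2 * V + 4 * QC) + 8 <= W.
  apply: leq_trans hW'; rewrite /V; lia.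
clear hW' mlp'; clearbody QC V.
have le1 : 'C(m * C2 + M, s) <= 'C(m.+1 * W - w, s).
  apply: leq_bin2l.
  have : m * C2 <= m * (W + V) by rewrite leq_mul2l hC2 orbT.
  rewrite mulSn mulnDr; move: (m * W) (m * V) (m * C2) hW2; lia.
have le2 : (if (1 < s) && (1 < m) then QC * C2 * 'C(2 * C2 + M, s - 2) else 0)
   <= 'C(m.+1 * W - w, s).
  case: ifP => // /andP[s1 m2].
  (* [m.+1 >= 3], so [W] is to spare: half of it holds two further members. *)
  have h := bin_two (4 * QC) (W %/ 2) (2 * C2 + M) (s - 2).
  have -> : s = (s - 2).+2 by lia.
  rewrite subSS subSS subn0.
  apply: leq_trans; first apply: (leq_trans _ h).
    rewrite leq_mul2r; apply/orP; right.
    have -> : 4 * QC * (W %/ 2) = QC * (4 * (W %/ 2)) by lia.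
    rewrite leq_mul2l; apply/orP; right.
    have : V <= m * V by rewrite leq_pmull //; lia.
    move: (m * V) hW2; lia.
  apply: leq_bin2l.
  have : 3 * W <= m.+1 * W by rewrite leq_mul2r; lia.
  have : V <= m * V by rewrite leq_pmull //; lia.
  move: (m * V) (m.+1 * W) hW2; lia.
apply: leq_trans (_ : c * C3 * ((l + p).+1 * 'C(m.+1 * W - w, s)) <= _).
  by rewrite leq_mul2l mulSn addnC leq_add ?orbT // leq_mul2l le1 orbT.
by rewrite mulnA -eqw.
Qed.

(** The families through an exceptional set [B], which avoids [D] but does not
    contain [L].  A typical set of [X] has one point [i] of [L] and one point [d] of
    [D], with [i] in [B]; such pairs [(i, d)] are edges of a complete bipartite
    graph, in which pairwise intersecting edges form a star.  A star at [i] has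
    [#|D|] edges, a star at [d] has at most [#|L| - 1] since [B] misses a point of
    [L]: in both cases fewer than some star has once [D] gains a point. *)
Section Near.
Variable T : finType.
Variables (k c : nat) (L D B : {set T}) (R X : {set {set T}}).
Let l := #|L|.
Let p := #|D|.
Let C2 := 'C(#|T| - 2, k - 2).
Let C3 := 'C(#|T| - 3, k - 3).
Hypothesis DL : D :&: L = set0.
Hypothesis cR : #|R| <= c * C3.
Hypothesis Bk : #|B| = k.
Hypothesis BL : B :&: L != set0.
Hypothesis LB : ~~ (L \subset B).
Hypothesis BD : B :&: D = set0.
Hypothesis XQ : X \subset meets (touching k L) D :|: R.
Hypothesis XB : {in X, forall A, A :&: B != set0}.
Hypothesis Rk : R \subset kfam T k.

Let DnL x : x \in D -> x \in L = false.
Proof. by move=> xD; apply/negP => xL; have : x \in D :&: L; [rewrite inE xD | rewrite DL inE]. Qed.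
Let BnD x : x \in B -> x \in D = false.
Proof. by move=> xB; apply/negP => xL; have : x \in B :&: D; [rewrite inE xB | rewrite BD inE]. Qed.

Definition paired i d (A : {set T}) := A :&: (L :|: D) == [set i; d].
Let I := B :&: L.
Let N := [set A in X | [exists i in I, exists d in D, paired i d A]].

Let pairedP A : reflect (A \in X /\ exists i d, [/\ i \in B, i \in L, d \in D & paired i d A]) (A \in N).
Proof.
rewrite inE; apply: (iffP andP) => -[AX].
  case/exists_inP => i; rewrite inE => /andP[iB iL] /exists_inP[d dD h].
  by split=> //; exists i, d.
case=> i [d [iB iL dD h]]; split=> //.
by apply/exists_inP; exists i; rewrite ?inE ?iB //; apply/exists_inP; exists d.
Qed.

Let paired_in i d A : paired i d A -> i \in A /\ d \in A.
Proof.
move/eqP => e; split.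
  by have : i \in A :&: (L :|: D); [rewrite e !inE eqxx | case/setIP].
by have : d \in A :&: (L :|: D); [rewrite e !inE eqxx orbT | case/setIP].
Qed.

Let paired_L i d A x : d \in D -> paired i d A -> x \in A -> x \in L -> x = i.
Proof.
move=> dD /eqP e xA xL; have : x \in A :&: (L :|: D) by rewrite !inE xA xL.
by rewrite e !inE => /orP[/eqP//|/eqP xd]; rewrite xd DnL in xL.
Qed.

Let paired_D i d A x : i \in L -> paired i d A -> x \in A -> x \in D -> x = d.
Proof.
move=> iL /eqP e xA xD; have : x \in A :&: (L :|: D) by rewrite !inE xA xD orbT.
by rewrite e !inE => /orP[/eqP xi|/eqP//]; rewrite -xi DnL in iL.
Qed.

Let neqLD i d : i \in L -> d \in D -> i != d.
Proof. by move=> iL dD; apply: contraTneq iL => ->; rewrite DnL. Qed.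

Let Xk : X \subset kfam T k.
Proof.
apply: subset_trans XQ _; rewrite subUset Rk andbT.
by apply: subset_trans (meets_sub _ _) (meets_sub _ _).
Qed.

Let subk (Y : {set {set T}}) : Y \subset X -> Y \subset kfam T k.
Proof. by move=> YX; apply: subset_trans YX Xk. Qed.

Let cB A : A \in X -> #|A| <= k.
Proof. by move=> /(subsetP Xk); rewrite inE => /eqP ->. Qed.

(** Such a set lies in [R] or has a third point in the bounded set
    [L :|: D :|: B]. *)
Lemma card_not_paired : #|X :\: N| <= (c + l * p * (l + p + k)) * C3.
Proof.
rewrite mulnDl -(cardsID R); apply: leq_add.
  by apply: leq_trans cR; apply: subset_leq_card; apply: subsetIr.
have Bc : #|L :|: D :|: B| <= l + p + k.
  rewrite -Bk; apply: leq_trans (leq_of_leqif (leq_card_setU _ _)) _.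
  by rewrite leq_add2r; apply: leq_of_leqif (leq_card_setU _ _).
apply: (@card_hit3 T k _ L (fun=> D) (fun _ _ => L :|: D :|: B) p (l + p + k)) => //.
  by apply: subk; apply: subset_trans (subsetDl _ _) (subsetDl _ _).
move=> A /setDP[/setDP[AX AN] AR].
have := subsetP XQ _ AX; rewrite inE (negbTE AR) orbF !inE => /andP[/andP[_ /interP[i iA iL]] /interP[d dA dD]].
have id := neqLD iL dD.
case: (set_0Vmem ((A :&: (L :|: D)) :\: [set i; d])) => [e|[x]]; last first.
  rewrite !inE negb_or => /andP[/andP[xi xd] /andP[xA xLD]].
  exists i, d, x; split; split=> //; rewrite ?inE ?xLD //.
  - by rewrite eq_sym.
  - by rewrite eq_sym.
have ni : paired i d A.
  rewrite /paired eqEsubset -setD_eq0 e eqxx /= subUset !sub1set !inE iA dA iL dD orbT //.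
have [x xA xB] := interP _ _ (XB AX).
have iB : i \notin B.
  by apply: contra AN => iB; apply/pairedP; split=> //; exists i, d.
exists i, d, x; split; split; rewrite ?inE ?xB ?orbT //.
  by apply: contraNneq iB => ->.
by apply: contraTneq dD => ->; rewrite BnD.
Qed.

(** The first summand counts the families whose typical members form a star, the
    second one those with two typical members whose pairs are disjoint. *)
Lemma int_count_near s M m :
  M = (c + l * p * (l + p + 3 * k)) * C3 -> m = maxn p (l - 1) ->
  int_count X s <= (l + p) * 'C(m * C2 + M, s)
     + (if (1 < s) && (1 < m) then l * p * C2 * (l * p * k * C3) * 'C(2 * C2 + M, s - 2) else 0).
Proof.
move=> eM em.
have alg a b z : (c + a * (b + 3 * k)) * z = (c + a * (b + k)) * z + a * (2 * k) * z.
  by clear; lia.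
have cI : #|I| <= l - 1.
  have : I \proper L.
    rewrite properEneq subsetIr andbT; apply: contra LB => /eqP <-; apply: subsetIl.
  by move=> /proper_card; rewrite /l; lia.
have nnM : (c + l * p * (l + p + k)) * C3 <= M.
  rewrite eM leq_mul2r leq_add2l leq_mul2l; apply/orP; right; apply/orP; right; lia.
pose Xn := X :\: N.
have cXn : #|Xn| <= M by apply: leq_trans card_not_paired nnM.
pose Pi i := [set A in N | i \in A].
pose U (Y : {set {set T}}) := [set G : {set {set T}} | (G \subset Y) && (#|G| == s)].
have hU v : v \in I :|: D -> #|U (Pi v :|: Xn)| <= 'C(m * C2 + M, s).
  move=> vID; rewrite cards_draws; apply: leq_bin2l.
  apply: leq_trans (leq_of_leqif (leq_card_setU _ _)) _; apply: leq_add => //.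
  have PX : Pi v \subset kfam T k.
    apply: subk; apply/subsetP => A; rewrite inE => /andP[/pairedP[]] //.
  case/setUP: vID => [vI|vD].
    have h : #|Pi v| <= #|[set v]| * p * C2.
      apply: (@card_hit2 T k _ _ (fun=> D) p) => // A; rewrite inE => /andP[/pairedP[_ [i [d [iB iL dD ni]]]] vA].
      have [_ dA] := paired_in ni.
      exists v, d; split; rewrite ?inE //; apply: neqLD => //; by case/setIP: vI.
    by apply: leq_trans h _; rewrite cards1 mul1n leq_mul2r em leq_maxl orbT.
  have h : #|Pi v| <= #|[set v]| * #|I| * C2.
    apply: (@card_hit2 T k _ _ (fun=> I) #|I|) => // A; rewrite inE => /andP[/pairedP[_ [i [d [iB iL dD ni]]]] vA].
    have [iA _] := paired_in ni.
    exists v, i; split; rewrite ?inE ?iB //; rewrite eq_sym; exact: neqLD.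
  apply: leq_trans h _; rewrite cards1 mul1n leq_mul2r em; apply/orP; right; lia.
(* Typical sets with disjoint pairs meet elsewhere, hence in a third point. *)
pose opp A := [set A' in N | [&& A' :&: A != set0 & (A' :&: A) :&: (L :|: D) == set0]].
pose V A A' := [set G : {set {set T}} | [&& [set A; A'] \subset G,
                 G :\: [set A; A'] \subset meets (meets X A) A' & #|G| == s]].
have cov : intfams X s \subset
   (\bigcup_(v in I :|: D) U (Pi v :|: Xn)) :|: \bigcup_(A in N) \bigcup_(A' in opp A) V A A'.
  apply/subsetP => G; rewrite inE => /and3P[GX Gs /intersectingP Gi].
  have spl v : (forall A, A \in G -> A \in N -> v \in A) -> v \in I :|: D ->
     G \in (\bigcup_(v in I :|: D) U (Pi v :|: Xn)) :|: \bigcup_(A in N) \bigcup_(A' in opp A) V A A'.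
    move=> h vID; rewrite inE; apply/orP; left; apply/bigcupP; exists v => //.
    rewrite inE Gs andbT; apply/subsetP => A AG; rewrite !in_setU in_setD (subsetP GX) //.
    case AN: (A \in N); rewrite ?orbT //=.
    by rewrite inE AN h.
  case: (set_0Vmem (G :&: N)) => [e|[A1 /setIP[A1G A1N]]].
    have [x xB xL] := interP _ _ BL.
    apply: (spl x) => [A AG AN|]; last by rewrite !inE xB xL.
    by have : A \in G :&: N; [rewrite inE AG | rewrite e inE].
  have [A1X [i [d [iB iL dD ni]]]] := pairedP _ A1N.
  have dead A A' : A \in G -> A' \in G -> A \in N -> A' \in N -> (A' :&: A) :&: (L :|: D) == set0 ->
     G \in (\bigcup_(v in I :|: D) U (Pi v :|: Xn)) :|: \bigcup_(A in N) \bigcup_(A' in opp A) V A A'.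
    move=> AG A'G AN A'N e; rewrite inE; apply/orP; right.
    apply/bigcupP; exists A => //; apply/bigcupP; exists A'.
      by rewrite inE A'N e Gi.
    rewrite inE Gs andbT subUset !sub1set AG A'G /=.
    apply/subsetP => C /setDP[CG _]; rewrite !inE (subsetP GX) //= !Gi //.
  case: (boolP [forall A in G, (A \in N) ==> (i \in A)]) => [/forall_inP h|].
    apply: (spl i) => [A AG AN|]; last by rewrite !inE iB iL.
    exact: (implyP (h _ AG)).
  rewrite negb_forall_in => /exists_inP[A2 A2G]; rewrite negb_imply => /andP[A2N iA2].
  have [A2X [i2 [d2 [i2B i2L d2D ni2]]]] := pairedP _ A2N.
  have [iA1 dA1] := paired_in ni; have [i2A2 d2A2] := paired_in ni2.
  have emp A A' j e j' e' : j \in L -> e \in D -> j' \in L -> e' \in D -> paired j e A -> paired j' e' A' ->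
       j != j' -> e != e' -> (A' :&: A) :&: (L :|: D) == set0.
    move=> jL eD jL' eD' nA nA' jj ee; rewrite -subset0; apply/subsetP => x.
    rewrite in_set0 => /setIP[/setIP[xA' xA] /setUP[xL|xD]].
      by move: jj; rewrite -(paired_L eD nA xA xL) -(paired_L eD' nA' xA' xL) eqxx.
    by move: ee; rewrite -(paired_D jL nA xA xD) -(paired_D jL' nA' xA' xD) eqxx.
  have ii2 : i != i2 by apply: contraNneq iA2 => ->.
  (* [A1] and [A2] share [d]; a member without [d] cannot share a point of its pair
     with both. *)
  case: (eqVneq d d2) => [dd|dd]; last exact: (dead A1 A2 _ _ _ _ (emp _ _ _ _ _ _ iL dD i2L d2D ni ni2 ii2 dd)).
  case: (boolP [forall A in G, (A \in N) ==> (d \in A)]) => [/forall_inP h|].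
    apply: (spl d) => [A AG AN|]; last by rewrite inE dD orbT.
    exact: (implyP (h _ AG)).
  rewrite negb_forall_in => /exists_inP[A3 A3G]; rewrite negb_imply => /andP[A3N dA3].
  have [A3X [i3 [d3 [i3B i3L d3D ni3]]]] := pairedP _ A3N.
  have [i3A3 d3A3] := paired_in ni3.
  have dd3 : d != d3 by apply: contraNneq dA3 => ->.
  case: (eqVneq i i3) => [ii3|ii3].
    apply: (dead A2 A3) => //; apply: (emp _ _ _ _ _ _ i2L d2D i3L d3D ni2 ni3).
      by rewrite -ii3 eq_sym.
    by rewrite -dd.
  exact: (dead A1 A3 _ _ _ _ (emp _ _ _ _ _ _ iL dD i3L d3D ni ni3 ii3 dd3)).
rewrite int_countE; apply: leq_trans (subset_leq_card cov) _.
apply: leq_trans (leq_of_leqif (leq_card_setU _ _)) _; apply: leq_add.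
  apply: leq_trans (card_bigcup_le _ _) _.
  apply: (@leq_trans (\sum_(v in I :|: D) 'C(m * C2 + M, s))); first by apply: leq_sum.
  rewrite sum_nat_const leq_mul2r; apply/orP; right.
  apply: leq_trans (leq_of_leqif (leq_card_setU _ _)) _; rewrite leq_add2r; lia.
have cN : #|N| <= l * p * C2.
  apply: (@card_hit2 T k _ L (fun=> D) p) => // [|A].
    by apply: subk; apply/subsetP => A; rewrite inE => /andP[].
  case/pairedP => _ [i [d [iB iL dD ni]]]; have [iA dA] := paired_in ni.
  by exists i, d; split=> //; apply: neqLD.
have copp A : A \in N -> #|opp A| <= l * p * k * C3.
  case/pairedP=> AX _.
  apply: (@card_hit3 T k _ L (fun=> D) (fun _ _ => A) p k) => // [|a b|A'].
  - by apply: subk; apply/subsetP => A'; rewrite inE => /andP[/pairedP[]].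
  - exact: cB.
  rewrite inE => /and3P[/pairedP[A'X [i [d [iB iL dD ni]]]] /interP[x xA' xA] /eqP e].
  have [iA' dA'] := paired_in ni.
  have xLD : x \notin L :|: D.
    by apply/negP => h; have : x \in A' :&: A :&: (L :|: D); [rewrite 2!inE xA' xA | rewrite e inE].
  exists i, d, x; split; split=> //; first exact: neqLD.
    by apply: contraNneq xLD => <-; rewrite inE iL.
  by apply: contraNneq xLD => <-; rewrite inE dD orbT.
have cV A A' : A \in N -> A' \in opp A ->
   #|V A A'| <= if (1 < s) && (1 < m) then 'C(2 * C2 + M, s - 2) else 0.
  move=> AN; rewrite inE => /and3P[A'N _ /eqP e].
  have [AX [i [d [iB iL dD ni]]]] := pairedP _ AN.
  have [A'X [i' [d' [i'B i'L d'D ni']]]] := pairedP _ A'N.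
  have [iA dA] := paired_in ni; have [i'A' d'A'] := paired_in ni'.
  have sep x : x \in A -> x \in A' -> x \in L :|: D -> False.
    by move=> xA xA' h; have : x \in A' :&: A :&: (L :|: D); [rewrite 2!inE xA' xA | rewrite e inE].
  have ii : i != i' by apply/eqP => h; apply: (sep i); rewrite // ?h // inE i'L.
  have dd : d != d' by apply/eqP => h; apply: (sep d); rewrite // ?h // inE d'D orbT.
  (* [i] and [i'] both lie in [B], which misses a point of [L], so [#|L| >= 3]. *)
  have m2 : 1 < m.
    have : #|[set i; i']| <= #|I|.
      by apply: subset_leq_card; rewrite subUset !sub1set !inE iB iL i'B i'L.
    by rewrite cards2 ii em leq_max => h; rewrite [1 < l - 1](leq_trans h cI) orbT.
  have AA' : A != A' by apply/eqP => h; apply: (sep i); rewrite -?h // inE iL.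
  apply: leq_trans (card_squeezed _ _ _) _; rewrite cards2 AA' m2 andbT.
  case: ifP => // s2; apply: leq_bin2l.
  (* A pair that meets both [(i, d)] and [(i', d')] is [(i, d')] or [(i', d)]. *)
  pose Y1 := [set C in kfam T k | [set i; d'] \subset C].
  pose Y2 := [set C in kfam T k | [set i'; d] \subset C].
  pose Y := meets (meets X A) A'.
  have bound2 a b : a != b -> #|[set C in kfam T k | [set a; b] \subset C]| <= C2.
    by move=> ab; have := card_containing k [set a; b]; rewrite cards2 ab.
  have YX : Y \subset X by apply: subset_trans (meets_sub _ _) (meets_sub _ _).
  have c1 : #|Y :\: N| <= (c + l * p * (l + p + k)) * C3.
    by apply: leq_trans card_not_paired; apply: subset_leq_card; apply: setSD.
  have c2 : #|(Y :&: N) :\: (Y1 :|: Y2)| <= l * p * (2 * k) * C3.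
    apply: (@card_hit3 T k _ L (fun=> D) (fun _ _ => A :|: A') p (2 * k)) => // [|_ _|C].
    - by apply: subk; apply: subset_trans (subsetDl _ _) _; apply: subset_trans (subsetIl _ _) YX.
    - apply: leq_trans (leq_of_leqif (leq_card_setU _ _)) _.
      by rewrite mul2n -addnn leq_add // cB.
    case/setDP => /setIP[CY CN] CnY.
    have [CX [j [b [jB jL bD nj]]]] := pairedP _ CN; have [jC bC] := paired_in nj.
    move: CY; rewrite !inE => /andP[/andP[_ /interP[x xC xA]] /interP[y yC yA']].
    have good z : z \in C -> z \in A :|: A' -> z != j -> z != b ->
       exists a b0 c0, [/\ [/\ a \in L, b0 \in D & c0 \in A :|: A'],
          [/\ a != b0, a != c0 & b0 != c0] & [/\ a \in C, b0 \in C & c0 \in C]].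
      move=> zC zA zj zb; exists j, b, z; split; split=> //; first exact: neqLD.
        by rewrite eq_sym.
      by rewrite eq_sym.
    case: (boolP ((x != j) && (x != b))) => [/andP[xj xb]|xjb].
      by apply: (good x) => //; rewrite inE xA.
    case: (boolP ((y != j) && (y != b))) => [/andP[yj yb]|yjb].
      by apply: (good y) => //; rewrite inE yA' orbT.
    have Ck : #|C| == k by have := subsetP Xk _ CX; rewrite inE.
    case/negP: CnY; rewrite !inE Ck /= !subUset !sub1set.
    move: xjb yjb; rewrite !negb_and !negbK => /orP[] /eqP ex /orP[] /eqP ey; subst.
    + by case: (sep j) => //; rewrite inE jL.
    + by rewrite -(paired_L dD ni xA jL) -(paired_D i'L ni' yA' bD) jC bC.
    + by rewrite -(paired_D iL ni xA bD) -(paired_L d'D ni' yA' jL) jC bC orbT.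
    + by case: (sep b) => //; rewrite inE bD orbT.
  rewrite -/Y -(cardsID N Y) -(cardsID (Y1 :|: Y2) (Y :&: N)).
  have c3 : #|Y :&: N :&: (Y1 :|: Y2)| <= 2 * C2.
    apply: leq_trans (subset_leq_card (subsetIr _ _)) _.
    apply: leq_trans (leq_of_leqif (leq_card_setU _ _)) _.
    by rewrite mul2n -addnn; apply: leq_add; apply: bound2; exact: neqLD.
  have -> : M = (c + l * p * (l + p + k)) * C3 + l * p * (2 * k) * C3.
    by rewrite eM alg.
  by rewrite -addnA; apply: leq_add => //; rewrite addnC; apply: leq_add.
apply: leq_trans (card_bigcup_le _ _) _.
set z := (if _ then 'C(_, _) else 0) in cV.
have -> : (if (1 < s) && (1 < m) then l * p * C2 * (l * p * k * C3) * 'C(2 * C2 + M, s - 2) else 0)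
    = l * p * C2 * (l * p * k * C3 * z) by rewrite /z; case: (_ && _); rewrite ?muln0 // [RHS]mulnA.
apply: (@leq_trans (\sum_(A in N) (l * p * k * C3 * z))); last first.
  by rewrite sum_nat_const leq_mul2r cN orbT.
apply: leq_sum => A AN; apply: leq_trans (card_bigcup_le _ _) _.
apply: (@leq_trans (\sum_(A' in opp A) z)); first by apply: leq_sum => A' A'o; apply: cV.
by rewrite sum_nat_const leq_mul2r copp ?orbT.
Qed.

End Near.

(** A few exceptional sets [R] that avoid [D] are worth less than all the sets
    through a new point [y].  Those that contain [L] meet every set of
    [touching k L] and are replaced one for one.  The families through another
    exceptional set are bounded by [int_count_near], and a star of the family with
    [y] makes up for them: the star of a point of [L], which gains an edge, or the
    star of [y] itself, whichever is larger. *)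
Lemma int_count_transversal_le (T : finType) (k c : nat) (L D : {set T}) (y : T)
    (R : {set {set T}}) (t : nat) :
  2 < k -> k <= #|T| -> L != set0 -> D :&: L = set0 -> y \notin L :|: D ->
  R \subset touching k L -> {in R, forall B : {set T}, B :&: D = set0} ->
  #|R| <= c * 'C(#|T| - 3, k - 3) ->
  #|[set B in R | L \subset B]| <= #|[set B in kfam T k | B :&: (L :|: (y |: D)) == y |: L]| ->
  trans_const #|L| #|D| k c * 'C(#|T| - 3, k - 3) <= 'C(#|T| - (#|L| + #|D|).+1, k - 2) ->
  int_count (meets (touching k L) D :|: R) t <= int_count (meets (touching k L) (y |: D)) t.
Proof.
move=> k2 kn L0 DL yLD RL RD cR cZ hW; case: t => [|s]; first by rewrite !int_count0.
set C3 := 'C(_ - 3, _) in cR hW; set W := 'C(_ - _.+1, _) in hW.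
set Q := meets _ D; set QK := meets _ (y |: D).
pose Za := [set B in R | L \subset B].
pose Za' := [set B in kfam T k | B :&: (L :|: (y |: D)) == y |: L].
have [yL yD] : y \notin L /\ y \notin D by move: yLD; rewrite inE negb_or => /andP.
have Rk : R \subset kfam T k by apply: subset_trans RL (meets_sub _ _).
have QKsub : Q \subset QK.
  apply/subsetP => A; rewrite !inE => /andP[-> /interP[x xA xD]] /=.
  by apply/interP; exists x; rewrite // inE xD orbT.
have Za'in B : B \in Za' -> [/\ #|B| = k, L \subset B, y \in B & B :&: D = set0].
  rewrite !inE => /andP[/eqP Bk /eqP e]; split=> //.
  - apply/subsetP => x xL; have : x \in B :&: (L :|: (y |: D)) by rewrite e inE xL orbT.
    by case/setIP.
  - by have : y \in B :&: (L :|: (y |: D)); [rewrite e setU11 | case/setIP].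
  - apply/eqP; rewrite -subset0; apply/subsetP => x /setIP[xB xD].
    have : x \in B :&: (L :|: (y |: D)) by rewrite !inE xB xD !orbT.
    rewrite e => /setU1P[xy|xL]; first by rewrite -xy xD in yD.
    by have : x \in D :&: L; [rewrite inE xD | rewrite DL].
have [x0 x0L] : exists x, x \in L by apply/set0Pn.
have Za'K : Za' \subset QK.
  apply/subsetP => B /Za'in[Bk LB yB _]; rewrite !inE Bk eqxx /=; apply/andP; split.
    by apply/interP; exists x0 => //; apply: (subsetP LB).
  by apply/interP; exists y => //; rewrite setU11.
have QL A : A \in Q -> A :&: L != set0 by rewrite !inE => /andP[/andP[]].
have QZ (Z : {set {set T}}) : {in Z, forall B : {set T}, B :&: D = set0} -> Q :&: Z = set0.
  move=> hZ; apply/eqP; rewrite -subset0; apply/subsetP => A /setIP[AQ /hZ e].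
  by move: AQ; rewrite !inE e eqxx andbF.
have cone (Z : {set {set T}}) : {in Z, forall B : {set T}, L \subset B} -> {in Z & Q :|: Z, forall A B : {set T}, B :&: A != set0}.
  move=> hZ A B AZ /setUP[/QL/interP[x xB xL]|BZ]; apply/interP.
    by exists x => //; apply: (subsetP (hZ _ AZ)).
  by exists x0; [apply: (subsetP (hZ _ BZ)) | apply: (subsetP (hZ _ AZ))].
have step2 : int_count (Q :|: Za) s.+1 <= int_count (Q :|: Za') s.+1.
  apply: int_count_cone_le => //.
  - by apply: QZ => B; rewrite inE => /andP[/RD].
  - by apply: QZ => B /Za'in[].
  - by apply: cone => B; rewrite inE => /andP[].
  - by apply: cone => B /Za'in[].
have step1 : int_count (Q :|: R) s.+1 <= int_count (Q :|: Za) s.+1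
    + \sum_(B in R :\: Za) int_count (meets ((Q :|: R) :\ B) B) s.
  rewrite !int_countE.
  apply: (@leq_trans #|intfams (Q :|: Za) s.+1 :|:
     \bigcup_(B in R :\: Za) [set G in intfams (Q :|: R) s.+1 | B \in G]|).
    apply: subset_leq_card; apply/subsetP => G GF; rewrite in_setU.
    case: (set_0Vmem (G :&: (R :\: Za))) => [e|[B /setIP[BG BR]]]; last first.
      by apply/orP; right; apply/bigcupP; exists B => //; rewrite inE GF.
    apply/orP; left; move: GF; rewrite !inE => /and3P[/subsetP GF -> ->]; rewrite !andbT.
    apply/subsetP => A AG; have := GF _ AG; rewrite !in_setU => /orP[->//|AR].
    apply/orP; right; apply/negPn/negP => AZ.
    by have : A \in G :&: (R :\: Za); [rewrite !in_setI in_setD AG AR AZ | rewrite e inE].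
  apply: leq_trans (leq_of_leqif (leq_card_setU _ _)) _; rewrite leq_add2l.
  apply: leq_trans (card_bigcup_le _ _) _; apply: leq_sum => B /setDP[BR _].
  rewrite card_through // ?in_setU ?BR ?orbT //.
  have := subsetP Rk _ BR; rewrite inE => /eqP Bk; rewrite -card_gt0 Bk; apply: ltn_trans k2 => //.
case: (set_0Vmem (R :\: Za)) => [e|[B0 /setDP[B0R B0Z]]].
  move: step1; rewrite e big_set0 addn0 => step1.
  apply: leq_trans step1 (leq_trans step2 _); apply: int_countS.
  by rewrite subUset QKsub Za'K.
(* [B0] meets [L] without containing it. *)
have l2 : 1 < #|L|.
  have [x xB xL] : exists2 x, x \in B0 & x \in L.
    by have := subsetP RL _ B0R; rewrite inE => /andP[_ /interP].
  have [z zL zB] : exists2 z, z \in L & z \notin B0.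
    by apply/subsetPn; move: B0Z; rewrite inE B0R.
  have : #|[set x; z]| <= #|L| by apply: subset_leq_card; rewrite subUset !sub1set xL zL.
  by rewrite cards2 (_ : x != z) //; apply: contraNneq zB => <-.
have C3p : 0 < C3 by rewrite bin_gt0 leq_sub2r.
set C2 := 'C(#|T| - 2, k - 2).
have hC2 : C2 <= W + (#|L| + #|D|) * C3.
  have := bin_pascal_iter (#|T| - 3) (k - 3) (#|L| + #|D| - 1).
  have -> : (#|T| - 3).+1 = #|T| - 2 by clear -k2 kn; lia.
  have -> : (k - 3).+1 = k - 2 by clear -k2; lia.
  have -> : #|T| - 2 - (#|L| + #|D| - 1) = #|T| - (#|L| + #|D|).+1 by clear -l2; lia.
  move=> h; apply: leq_trans h _; rewrite leq_add2l leq_mul2r leq_subr orbT //.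
pose M := (c + #|L| * #|D| * (#|L| + #|D| + 3 * k)) * C3.
pose m := maxn #|D| (#|L| - 1).
pose w := c * (#|L| + #|D| + 1) * C3.
have num := @trans_numeric #|L| #|D| k c C2 C3 W s M m w C3p l2 hC2 hW erefl erefl erefl.
set nb := (_ + _) in num.
have step3 : \sum_(B in R :\: Za) int_count (meets ((Q :|: R) :\ B) B) s <= w * 'C(m.+1 * W - w, s).
  apply: leq_trans num; apply: (@leq_trans (\sum_(B in R :\: Za) nb)); last first.
    rewrite sum_nat_const leq_mul2r; apply/orP; right.
    by apply: leq_trans cR; apply: subset_leq_card; apply: subsetDl.
  apply: leq_sum => B /setDP[BR BZ].
  apply: (@int_count_near T k c L D B R _ DL cR) => //.
  - by have := subsetP Rk _ BR; rewrite inE => /eqP.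
  - by have := subsetP RL _ BR; rewrite inE => /andP[].
  - by move: BZ; rewrite inE BR.
  - exact: RD.
  - by apply: subset_trans (meets_sub _ _) (subsetDl _ _).
  - by move=> A; rewrite inE => /andP[].
apply: leq_trans step1 _; apply: leq_trans (leq_add step2 step3) _.
have QBK : Q :|: Za' \subset QK by rewrite subUset QKsub.
pose Z := y |: (L :|: D).
have cardZ : #|Z| = (#|L| + #|D|).+1.
  by rewrite cardsU1 yLD cardsU setIC DL cards0 subn0.
have mW : w <= W.
  apply: leq_trans hW; rewrite leq_mul2r; apply/orP; right.
  by rewrite /trans_const; clear; lia.
have [i0 i0L] : exists x, x \in L by exists x0.
have inZ (A : {set T}) a b : A :&: Z = [set a; b] -> a \in A /\ b \in A.
  move=> e; split.
    by have : a \in A :&: Z; [rewrite e !inE eqxx | case/setIP].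
  by have : b \in A :&: Z; [rewrite e !inE eqxx orbT | case/setIP].
have notL (A : {set T}) a b : A :&: Z = [set a; b] -> a \in L -> b \notin L -> ~~ (L \subset A).
  move=> e aL bL; apply: contraTN l2 => /subsetP LA; rewrite -leqNgt.
  apply: leq_trans (_ : #|[set a]| <= 1); last by rewrite cards1.
  apply: subset_leq_card; apply/subsetP => x xL.
  have : x \in A :&: Z by rewrite !inE LA // xL orbT.
  by rewrite e !inE => /orP[//|/eqP xb]; rewrite -xb xL in bL.
have k1 : 1 < k by apply: ltn_trans k2.
case: (leqP (#|L| - 1) #|D|) => lp.
  have em : m = #|D| by rewrite /m; apply/maxn_idPl.
  (* Gain in the star of a point of [L]. *)
  pose P := broom k i0 (y |: D) Z.
  have i0yD : i0 \notin y |: D.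
    rewrite !inE negb_or; apply/andP; split; first by apply: contraNneq yL => <-.
    by apply/negP => h; have : i0 \in D :&: L; [rewrite inE h | rewrite DL inE].
  have cP : #|P| = m.+1 * W.
    rewrite card_broom //; first by rewrite cardsU1 yD cardZ em.
    by rewrite /Z subUset sub1set setU1r ?inE ?i0L //= setUS // subsetUr.
  have PK : P \subset QK.
    apply/subsetP => A /broomP[e eE [Ak /inZ[iA eA]]]; rewrite !inE Ak eqxx /=.
    by apply/andP; split; apply/interP; [exists i0 | exists e].
  have PQ : #|P :&: (Q :|: Za')| <= m * W.
    apply: (@leq_trans #|broom k i0 D Z|); last first.
      rewrite card_broom //; [by rewrite cardZ em| |by apply: contra i0yD; apply: setU1r].
      by rewrite /Z subUset sub1set setU1r ?inE ?i0L //= subsetU // subsetUr orbT.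
    apply: subset_leq_card; apply/subsetP => A /setIP[/broomP[e eE [Ak eA]] AQ].
    apply/broomP; exists e => //; have [iA eA'] := inZ _ _ _ eA.
    case/setU1P: (eE) => // ey; have eL : e \notin L by rewrite ey.
    case/setUP: AQ => [|/Za'in[_ LA _ _]].
      rewrite !inE => /andP[_ /interP[d dA dD]].
      have : d \in A :&: Z by rewrite !inE dA dD !orbT.
      rewrite eA => /set2P[di|de]; last by rewrite -de.
      by move: i0yD; rewrite -di !inE dD orbT.
    by case/negP: (notL _ _ _ eA i0L eL).
  have := int_count_gain s.+1 QBK PK (broom_intersecting _ _ _ _); rewrite cP => gain.
  have gain2 := bin_gain (m.+1 * W - w) w s.
  have e2 : m.+1 * W - w + w = m.+1 * W.
    by rewrite subnK // mulSn; apply: leq_trans mW (leq_addr _ _).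
  rewrite e2 in gain2.
  have le3 : 'C(#|P :&: (Q :|: Za')|, s.+1) <= 'C(m.+1 * W - w, s.+1).
    by apply: leq_bin2l; apply: leq_trans PQ _; rewrite mulSn; clear -mW; lia.
  clear -gain gain2 le3; lia.
have em : m = #|L| - 1 by rewrite /m; apply/maxn_idPr/ltnW.
have em1 : m.+1 = #|L| by rewrite em; clear -l2; lia.
(* Gain in the star of [y], none of whose families was counted before. *)
pose P := broom k y L Z.
have cP : #|P| = m.+1 * W.
  rewrite card_broom //; first by rewrite cardZ em1.
  by rewrite /Z setUS // subsetUl.
have PK : P \subset QK.
  apply/subsetP => A /broomP[e eE [Ak /inZ[iA eA]]]; rewrite !inE Ak eqxx /=.
  by apply/andP; split; apply/interP; [exists e | exists y; rewrite // setU11].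
have PQ : P :&: (Q :|: Za') = set0.
  apply/eqP; rewrite -subset0; apply/subsetP => A /setIP[/broomP[e eE [Ak eA]] AQ].
  have [yA eA'] := inZ _ _ _ eA.
  case/setUP: AQ => [|/Za'in[_ LA _ _]].
    rewrite !inE => /andP[_ /interP[d dA dD]].
    have : d \in A :&: Z by rewrite !inE dA dD !orbT.
    rewrite eA => /set2P[dy|de]; first by rewrite -dy dD in yD.
    by have : e \in D :&: L; [rewrite -de inE dD de | rewrite DL inE].
  by rewrite setUC in eA; case/negP: (notL _ _ _ eA eE yL).
have := int_count_gain s.+1 QBK PK (broom_intersecting _ _ _ _); rewrite cP PQ cards0 bin0n /= => gain.
have gain2 := bin_gain (m.+1 * W - w) w s.
have e2 : m.+1 * W - w + w = m.+1 * W.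
  by rewrite subnK // mulSn; apply: leq_trans mW (leq_addr _ _).
rewrite e2 in gain2.
clear -gain gain2; lia.
Qed.

(** * Optimality among families with enough full stars *)

Definition full_bound k l := k * (trans_const l k k (l * k * k) + l + k + k * k) + l + k + 3.

Lemma trans_const_mono l p k c : p <= k -> trans_const l p k c <= trans_const l k k c.
Proof.
move=> pk; rewrite /trans_const.
by rewrite !(leq_add, leq_mul, leq_add2l, leq_add2r, leq_mul2l, leq_mul2r, leqnn, pk, orbT).
Qed.

Section Hitting.
Variable T : finType.
Variables (k : nat) (L : {set T}) (H : {set {set T}}).
Let l := #|L|.
Hypothesis k1 : 1 < k.
Hypothesis l0 : 0 < l.
Hypothesis Hk : H \subset kfam T k.
Hypothesis HL : {in H, forall A : {set T}, A :&: L = set0}.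
Hypothesis nbig : full_bound k l <= #|T|.

Let D := [set x | [forall A in H, x \in A]].
Let Q := hitting (touching k L) H.
Let R := [set B in Q | B :&: D == set0].

Variable A0 : {set T}.
Hypothesis A0H : A0 \in H.
Hypothesis cD : #|D| <= k - 2.

(** A bounded set for the third point in [card_hit3], depending on the second. *)
Let miss u := odflt set0 [pick A in H | u \notin A].

Let missP u : u \notin D -> miss u \in H /\ u \notin miss u.
Proof.
rewrite inE negb_forall_in => /exists_inP[A AH uA]; rewrite /miss.
by case: pickP => [B /andP[]//|/(_ A)]; rewrite /= AH uA.
Qed.

Let cH A : A \in H -> #|A| = k.
Proof. by move=> /(subsetP Hk); rewrite inE => /eqP. Qed.

Let cmiss u : #|miss u| <= k.
Proof. by rewrite /miss; case: pickP => [B /andP[/cH->]|_] //=; rewrite cards0. Qed.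

Let disjL A x : A \in H -> x \in A -> x \notin L.
Proof.
move=> AH xA; apply/negP => xL; have : x \in A :&: L by rewrite inE xA.
by rewrite HL // inE.
Qed.

(** A set of [R] meets [A0] in a point outside [D], and then needs another point for
    a member that misses this one. *)
Let R3 B : B \in R -> exists i u v,
  [/\ [/\ i \in L, u \in A0 & v \in miss u], [/\ i != u, i != v & u != v]
       & [/\ i \in B, u \in B & v \in B]].
Proof.
rewrite inE => /andP[/hittingP[BT hB] /eqP BD].
move: BT; rewrite inE => /andP[_ /interP[i iB iL]].
have /interP[u uB uA0] := hB _ A0H.
have uD : u \notin D by apply/negP => uD; have : u \in B :&: D; [rewrite inE uB | rewrite BD inE].
have [mH um] := missP uD; have /interP[v vB vm] := hB _ mH.
exists i, u, v; split; split=> //.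
- by apply: contraTneq iL => ->; apply: disjL uA0.
- by apply: contraTneq iL => ->; apply: disjL vm.
- by apply: contraNneq um => e; rewrite {1}e.
Qed.

Let Rk : R \subset kfam T k.
Proof. by apply/subsetP => B; rewrite inE => /andP[/hittingP[]]; rewrite inE => /andP[]. Qed.

Let cR : #|R| <= l * k * k * 'C(#|T| - 3, k - 3).
Proof.
apply: (@card_hit3 T k R L (fun=> A0) (fun _ u => miss u) k k) => //.
by move=> _; rewrite cH.
Qed.

Let QsubDR : Q \subset meets (touching k L) D :|: R.
Proof.
apply/subsetP => B BQ; rewrite in_setU [B \in R]inE BQ inE.
by case/hittingP: BQ => -> _ /=; case: (_ == _).
Qed.

Let DL : D :&: L = set0.
Proof.
apply/eqP; rewrite -subset0; apply/subsetP => x /setIP[]; rewrite inE => /forall_inP h.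
by move/negP: (disjL A0H (h _ A0H)).
Qed.

(** Two further points are fixed on the left, one on the right. *)
Let containing_le y : y \notin L :|: D -> 2 < k ->
  #|[set B in R | L \subset B]| <= #|[set B in kfam T k | B :&: (L :|: (y |: D)) == y |: L]|.
Proof.
rewrite inE negb_or => /andP[yL yD] k2; have pk : #|D| <= k by lia.
case: (leqP (l + 2) k) => lk; last first.
  rewrite (_ : [set B in R | L \subset B] = set0) ?cards0 //; apply/setP => B; rewrite [LHS]inE [RHS]inE.
  apply/negbTE/negP => /andP[BR LB].
  have [i [u [v [[iL uA vm] [_ _ uv] [_ uB vB]]]]] := R3 BR.
  have : #|[set u; v] :|: L| <= #|B| by apply: subset_leq_card; rewrite !subUset !sub1set uB vB.
  have mH : miss u \in H.
    apply: (proj1 (missP _)); apply/negP => uD; move: BR; rewrite inE => /andP[_ /eqP e].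
    by have : u \in B :&: D; [rewrite inE uB | rewrite e inE].
  rewrite -setUA !cardsU1 in_setU1 (negbTE (disjL mH vm)) (negbTE (disjL A0H uA)) (negbTE uv) /=.
  by have := subsetP Rk _ BR; rewrite inE => /eqP->; clear -lk; rewrite /l in lk; lia.
have e1 : #|y |: L| = l.+1 by rewrite cardsU1 yL.
have e2 : #|L :|: (y |: D)| = l + #|D| + 1.
  rewrite cardsU (_ : L :&: _ = set0) ?cards0 ?subn0 ?cardsU1 ?yD; first by rewrite /l; lia.
  apply/eqP; rewrite -subset0; apply/subsetP => x /setIP[xL /setU1P[xy|xD]]; first by rewrite -xy xL in yL.
  by have : x \in D :&: L; [rewrite inE xD | rewrite DL].
rewrite card_trace ?e1 ?e2; [|by rewrite subUset sub1set !inE eqxx /= orbT subsetUl|by lia].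
apply: (@leq_trans (k * k * 'C(#|T| - (l + 2), k - (l + 2)))); last first.
  have h := @bin_dominate (k * k) #|D| (#|T| - (l + 2)) (k - (l + 2)).
  have e3 : (#|T| - (l + 2)).+1 - #|D| = #|T| - (l + #|D| + 1).
    by move: nbig pk; rewrite /full_bound; clear; lia.
  have e4 : (k - (l + 2)).+1 = k - l.+1 by clear -lk; lia.
  rewrite e3 e4 in h; apply: h.
  apply: (@leq_trans (k * (k * k + k))); first by apply: leq_mul; rewrite ?leq_add2l ?leq_subr.
  have := nbig; rewrite /full_bound; move: (trans_const _ _ _ _) => z; clear; lia.
apply: (@leq_trans #|\bigcup_(u in A0) \bigcup_(v in miss u | (u != v) && (v \notin L))
       [set B in kfam T k | [set u; v] :|: L \subset B]|).
  apply: subset_leq_card; apply/subsetP => B; rewrite inE => /andP[BR LB].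
  have [i [u [v [[iL uA vm] [_ _ uv] [_ uB vB]]]]] := R3 BR.
  apply/bigcupP; exists u => //; apply/bigcupP; exists v.
    rewrite vm uv; apply: disjL vm.
    apply: (proj1 (missP _)); apply/negP => uD; move: BR; rewrite inE => /andP[_ /eqP e].
    by have : u \in B :&: D; [rewrite inE uB | rewrite e inE].
  by rewrite inE (subsetP Rk) // !subUset !sub1set uB vB.
apply: leq_trans (card_bigcup_le _ _) _; rewrite -mulnA -[X in X * _](cH A0H) -sum_nat_const.
apply: leq_sum => u uA; apply: leq_trans (card_bigcup_le _ _) _.
apply: (@leq_trans (\sum_(v in miss u) 'C(#|T| - (l + 2), k - (l + 2)))); last first.
  by rewrite sum_nat_const leq_mul2r cmiss orbT.
rewrite big_mkcondr; apply: leq_sum => v _; case: ifP => // /andP[uv vL].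
have := card_containing k ([set u; v] :|: L).
rewrite -setUA !cardsU1 in_setU1 vL (negbTE (disjL A0H uA)) (negbTE uv) /=.
by rewrite add1n add1n addn2.
Qed.

(** Few common points leave room: [D] with one more point still fits into [K], and
    [int_count_transversal_le] applies. *)
Lemma int_count_hitting_spread (L' K : {set T}) (H' : {set {set T}}) s :
  #|L'| = l -> #|K| = k.-1 -> K :&: L' = set0 -> {in H', forall A : {set T}, K \subset A} ->
  int_count Q s <= int_count (hitting (touching k L') H') s.
Proof.
move=> cL' cK KL' hH'.
case: (leqP k 2) => k2.
  (* An edge has no room for the three points of [R3]. *)
  have D0 : D = set0 by apply: cards0_eq; apply/eqP; rewrite -leqn0; apply: leq_trans cD _; lia.
  rewrite (_ : Q = set0); first by apply: int_countS; apply: sub0set.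
  apply/eqP; rewrite -subset0; apply/subsetP => B BQ.
  have BR : B \in R by rewrite inE BQ D0 setI0 eqxx.
  have [i [u [v [_ [iu iv uv] [iB uB vB]]]]] := R3 BR.
  have : #|[set i; u; v]| <= #|B| by apply: subset_leq_card; rewrite !subUset !sub1set iB uB.
  rewrite -setUA cardsU1 cards2 uv !inE negb_or iu iv /=.
  by have := subsetP Rk _ BR; rewrite inE => /eqP->; rewrite leqNgt ltnS k2.
have pk : #|D| <= k by clear -cD; lia.
have [y yLD] : exists y, y \notin L :|: D.
  apply/existsP; rewrite -negb_forall; apply/negP => /forallP h.
  have : #|T| <= #|L :|: D| by rewrite -cardsT; apply: subset_leq_card; apply/subsetP => x _; apply: h.
  have := leq_of_leqif (leq_card_setU L D); have := nbig.
  rewrite /full_bound -/l; clear -pk; lia.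
apply: leq_trans (int_countS _ QsubDR) _.
apply: (@leq_trans (int_count (meets (touching k L) (y |: D)) s)).
  apply: (@int_count_transversal_le T k (l * k * k)) => //.
  - by have := nbig; rewrite /full_bound; clear; lia.
  - by rewrite -card_gt0.
  - by apply/subsetP => B; rewrite inE => /andP[/hittingP[]].
  - by move=> B; rewrite inE => /andP[_ /eqP].
  - exact: containing_le.
  rewrite -/l; have h := @bin_dominate (trans_const l #|D| k (l * k * k)) (l + #|D| - 1) (#|T| - 3) (k - 3).
  have nb := nbig; rewrite /full_bound in nb.
  (* The sets of order [n ^ (k - 3)] are dominated by those of order [n ^ (k - 2)]. *)
  have e3 : (#|T| - 3).+1 - (l + #|D| - 1) = #|T| - (l + #|D|).+1.
    by clear -nb pk l0; lia.
  have e4 : (k - 3).+1 = k - 2 by clear -k2; lia.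
  rewrite e3 e4 in h; apply: h.
  apply: (@leq_trans (k * (trans_const l k k (l * k * k) + (l + k)))).
    apply: leq_mul; first by rewrite leq_subr.
    apply: leq_add; first exact: trans_const_mono.
    by clear -pk; lia.
  by move: nb; move: (trans_const _ _ _ _) => z; clear; lia.
have [K1 K1K cK1] : exists2 K1 : {set T}, K1 \subset K & #|K1| = #|y |: D|.
  apply: subset_of_card; rewrite cK cardsU1; move: yLD; rewrite inE negb_or => /andP[_ ->].
  by clear -cD k2; lia.
have dis (X Y : {set T}) : X :&: Y = set0 -> [disjoint X & Y] by rewrite -setI_eq0 => ->.
have [|||f finj [fL fD _]] := @extend_inj3 T L (y |: D) set0 L' K1 set0.
- by rewrite cL' cK1 !cards0.
- split; apply: dis; rewrite ?setI0 //.
  rewrite setIUr [L :&: D]setIC DL setU0.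
  apply/eqP; rewrite -subset0; apply/subsetP => x /setIP[yL /set1P xy].
  by move: yLD; rewrite inE -xy yL.
- split; apply: dis; rewrite ?setI0 //.
  by apply/eqP; rewrite -subset0 -KL' setIC setSI.
apply: (@int_count_imset T T f _ _ s finj) => B; rewrite !inE => /andP[/andP[/eqP Bk /interP[x xB xL]] /interP[z zB zD]].
rewrite card_imset // Bk eqxx /=; apply/andP; split.
  by apply/interP; exists (f x); rewrite ?imset_f // -fL imset_f.
apply/forall_inP => A AH; apply/interP; exists (f z); first by rewrite imset_f.
apply: (subsetP (hH' _ AH)); apply: (subsetP K1K); by rewrite -fD imset_f.
Qed.

End Hitting.

(** The parts [H] outside [touching k L] either share a [k.-1]-set, where
    relabelling applies, or have fewer common points, where they leave room for
    fewer families. *)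
Lemma int_count_full_le (n k l r t : nat) (L : {set 'I_n}) (F : {set {set 'I_n}}) :
  1 < k -> 0 < l -> full_bound k l <= n -> r <= n - l - k + 1 ->
  #|L| = l -> F \subset ksets n k -> touching k L \subset F ->
  #|F| = 'C(n, k) - 'C(n - l, k) + r ->
  int_count F t <= int_count (lex_family n k #|F|) t.
Proof.
move=> k1 l0 nbig rn cL Fk LF cF.
have k0 : 0 < k by apply: ltnW.
have lkn : l + k <= n by move: nbig; rewrite /full_bound; clear -k0; nia.
rewrite cF; have [L' [K [R' [[cL' cK KL'] [-> cR' Rk' hR']]]]] := lex_family_structure k0 lkn rn.
pose S := touching k L; pose R := F :\: S.
have eF : F = S :|: R by rewrite -[LHS](setID F S) (setIidPr LF).
have SR : S :&: R = set0 by apply/setP => A; rewrite in_setI in_setD in_set0; case: (A \in S).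
have cR : #|R| = r.
  rewrite cardsD (setIidPr LF) cF card_touching card_ord cL; lia.
have Rk : R \subset kfam 'I_n k by apply: subset_trans (subsetDl _ _) Fk.
have hR (A : {set 'I_n}) : A \in R -> A :&: L = set0.
  move=> AR; have := subsetP Rk _ AR; move: AR; rewrite !inE => /andP[h _] Ak.
  by move: h; rewrite Ak /= negbK => /eqP.
have S'R' : touching k L' :&: R' = set0.
  apply/eqP; rewrite -subset0; apply/subsetP => A /setIP[]; rewrite inE => /andP[_ AL] /hR'[_ e].
  by rewrite e eqxx in AL.
rewrite eF; apply: int_count_split_le => //; first by rewrite cR cR'.
  apply/intersectingP => A B /hR'[KA _] /hR'[KB _].
  have /set0Pn[x xK] : K != set0 by rewrite -card_gt0 cK; lia.
  by apply/interP; exists x; [apply: (subsetP KA) | apply: (subsetP KB)].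
move=> H H' s HR HR' eH _.
have Hk : H \subset kfam 'I_n k by apply: subset_trans HR Rk.
have Hk' : H' \subset kfam 'I_n k by apply: subset_trans HR' Rk'.
have hH' : {in H', forall A : {set 'I_n}, K \subset A /\ A :&: L' = set0}.
  by move=> A /(subsetP HR') /hR'.
have hH : {in H, forall A : {set 'I_n}, A :&: L = set0} by move=> A /(subsetP HR) /hR.
have sun (D : {set 'I_n}) : #|D| = k.-1 -> D :&: L = set0 -> {in H, forall A : {set 'I_n}, D \subset A} ->
    int_count (hitting S H) s <= int_count (hitting (touching k L') H') s.
  move=> cD DL hD; apply: (@sunflower_hitting_le 'I_n k L D L' K) => //; first by rewrite cL cL'.
  by move=> A AH; split; [apply: hD | apply: hH].
case: (set_0Vmem H) => [H0|[A0 A0H]].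
  have [|D DL cD] := @subset_of_card _ (~: L) k.-1.
    by have := cardsC L; rewrite cL card_ord; clear -lkn k0; lia.
  apply: (sun D) => //; last by move=> A; rewrite H0 inE.
  by apply/eqP; rewrite setI_eq0 disjoints_subset.
pose D0 := [set x | [forall A in H, x \in A]].
case: (leqP k.-1 #|D0|) => cD0.
  have [D DD0 cD] := subset_of_card cD0.
  have hD : {in H, forall A : {set 'I_n}, D \subset A}.
    move=> A AH; apply/subsetP => x /(subsetP DD0); rewrite inE => /forall_inP; exact.
  apply: (sun D) => //; apply/eqP; rewrite -subset0 -(hH _ A0H); apply: setSI; exact: hD.
apply: (@int_count_hitting_spread 'I_n k L H k1 _ Hk hH _ A0 A0H _ L' K) => //.
- by rewrite cL.
- by rewrite cL card_ord.
- by move: cD0; rewrite -/D0; clear; lia.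
- by rewrite cL cL'.
- by move=> A /hH'[].
Qed.

(** * Intersecting families are mostly stars *)

(** A family that is not in the star of a point of [C] has a member that avoids
    [C], or all its members meet [C] twice, or it has a member [A] that meets [C]
    in [i] alone and a member [B] without [i].  In the last case [B] and all other
    members have two points in bounded sets. *)
Lemma int_count_stars_le (T : finType) k (C : {set T}) (F : {set {set T}}) x t M :
  0 < k -> F \subset kfam T k ->
  {in F, forall A, A :&: C == set0 -> #|meets (F :\ A) A| <= x} ->
  #|C|.+1 ^ 2 * k * 'C(#|T| - 2, k - 2) <= M ->
  int_count F t.+2 <= \sum_(i in C) 'C(deg F i, t.+2)
     + #|[set A in F | A :&: C == set0]| * 'C(x, t.+1) + 'C(M, t.+2) + #|F| * M * 'C(M, t).
Proof.
move=> k0 Fk hx eM; set U := [set A in F | _].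
pose b := #|C|; pose C2 := 'C(#|T| - 2, k - 2).
have cF A : A \in F -> #|A| = k by move=> /(subsetP Fk); rewrite inE => /eqP.
have sub (Y : {set {set T}}) : Y \subset F -> Y \subset kfam T k.
  by move=> YF; apply: subset_trans YF Fk.
have leM a : a <= #|C|.+1 ^ 2 * k -> a * C2 <= M by move=> h; apply: leq_trans eM; rewrite leq_mul2r h orbT.
pose Ma := [set A in F | 1 < #|A :&: C|].
pose opp A := [set B in F | [&& A :&: B :&: C == set0, B :&: C != set0 & B :&: A != set0]].
pose Y A B := [set D in F | [&& D :&: C != set0, D :&: A != set0 & D :&: B != set0]].
pose V A B := [set G : {set {set T}} | [&& [set A; B] \subset G,
                 G :\: [set A; B] \subset Y A B & #|G| == t.+2]].
pose Si := [set A in F | #|A :&: C| == 1].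
pose P (Z : {set {set T}}) := [set G : {set {set T}} | (G \subset Z) && (#|G| == t.+2)].
(* The four groups: in a star, with a member that avoids [C], all members meeting
   [C] twice, and with [A] and [B] as above. *)
have cov : intfams F t.+2 \subset
   (\bigcup_(i in C) P (star F i)) :|: (\bigcup_(A in U) [set G in intfams F t.+2 | A \in G])
   :|: P Ma :|: \bigcup_(A in Si) \bigcup_(B in opp A) V A B.
  apply/subsetP => G Gi; have := Gi; rewrite inE => /and3P[GF Gt /intersectingP hG]; rewrite !in_setU.
  case: (set_0Vmem (G :&: U)) => [e|[A /setIP[AG AU]]]; last first.
    by apply/orP; left; apply/orP; left; apply/orP; right; apply/bigcupP; exists A; rewrite // inE Gi.
  have touch A : A \in G -> A :&: C != set0.
    move=> AG; apply/negP => h; have : A \in G :&: U by rewrite !inE AG h (subsetP GF).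
    by rewrite e inE.
  case: (boolP (G \subset Ma)) => GMa.
    by apply/orP; left; apply/orP; right; rewrite inE GMa.
  have [A AG AMa] := subsetPn GMa.
  have /eqP/cards1P[i ei] : #|A :&: C| = 1.
    apply/eqP; rewrite eqn_leq card_gt0 (touch _ AG) andbT leqNgt; apply: contra AMa => h.
    by rewrite inE h (subsetP GF).
  have [iA iC] : i \in A /\ i \in C by have := set11 i; rewrite -ei inE => /andP[].
  case: (boolP (G \subset star F i)) => Gs.
    by apply/orP; left; apply/orP; left; apply/orP; left; apply/bigcupP; exists i; rewrite // inE Gs.
  have [B BG Bi] := subsetPn Gs; have iB : i \notin B by move: Bi; rewrite inE (subsetP GF).
  apply/orP; right; apply/bigcupP; exists A; first by rewrite inE ei cards1 (subsetP GF) //=.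
  apply/bigcupP; exists B.
    rewrite inE (subsetP GF) // (touch _ BG) hG //= andbT setIAC ei.
    by rewrite setI_eq0 disjoints1.
  rewrite inE Gt andbT subUset !sub1set AG BG /=; apply/subsetP => D /setDP[DG _].
  by rewrite inE (subsetP GF) // (touch _ DG) !hG.
rewrite int_countE; apply: leq_trans (subset_leq_card cov) _.
apply: leq_trans (leq_of_leqif (leq_card_setU _ _)) _; apply: leq_add.
  apply: leq_trans (leq_of_leqif (leq_card_setU _ _)) _; apply: leq_add.
    apply: leq_trans (leq_of_leqif (leq_card_setU _ _)) _; apply: leq_add.
      apply: leq_trans (card_bigcup_le _ _) _; apply: leq_sum => i _.
      by rewrite cards_draws.
    apply: leq_trans (card_bigcup_le _ _) _; rewrite -sum_nat_const; apply: leq_sum => A.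
    rewrite inE => /andP[AF AC]; rewrite card_through //.
      by apply: leq_trans (int_count_bin _ _) _; apply: leq_bin2l; apply: hx.
    by rewrite -card_gt0 cF.
  rewrite cards_draws; apply: leq_bin2l.
  apply: leq_trans (_ : b * b * C2 <= _); last by apply: leM; rewrite /b; clear -k0; nia.
  apply: (@card_hit2 T k Ma C (fun=> C) b) => //; first by apply: sub; apply/subsetP => A; rewrite inE => /andP[].
  move=> A; rewrite inE => /andP[_ /card_gt1P[a [a' [/setIP[aA aC] /setIP[a'A a'C] aa']]]].
  by exists a, a'.
have cV A B : A \in Si -> B \in opp A -> #|V A B| <= 'C(M, t).
  rewrite !inE => /andP[AF /cards1P[i ei]] /and4P[BF /eqP ABC BC BA].
  have iAC : i \in A /\ i \in C by have := set11 i; rewrite -ei inE => /andP[].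
  have [iA iC] := iAC.
  have iB : i \notin B.
    by apply/negP => iB; have : i \in A :&: B :&: C; [rewrite !inE iA iB | rewrite ABC inE].
  have AB : A != B by apply: contraNneq iB => <-.
  apply: leq_trans (card_squeezed _ _ _) _; rewrite cards2 AB /= subn2 /=; apply: leq_bin2l.
  apply: leq_trans (_ : b * (2 * k) * C2 <= _); last by apply: leM; rewrite /b; clear -k0; nia.
  apply: (@card_hit2 T k (Y A B) C (fun=> A :|: B) (2 * k)) => //.
  - by apply: sub; apply/subsetP => D; rewrite inE => /andP[].
  - move=> _; apply: leq_trans (leq_of_leqif (leq_card_setU _ _)) _.
    by rewrite mul2n -addnn !cF.
  move=> D; rewrite inE => /and4P[DF /interP[j jD jC] /interP[x1 x1D x1A] /interP[x2 x2D x2B]].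
  case: (boolP (i \in D)) => iD.
    exists i, x2; split; rewrite ?inE ?x2B ?orbT //.
    by apply: contraNneq iB => ->.
  exists j, x1; split; rewrite ?inE ?x1A //.
  apply: contraNneq iD => jx; have : x1 \in A :&: C by rewrite inE x1A -jx.
  by rewrite ei => /set1P <-.
apply: leq_trans (card_bigcup_le _ _) _.
apply: (@leq_trans (\sum_(A in Si) (M * 'C(M, t)))); last first.
  rewrite sum_nat_const -mulnA leq_mul2r subset_leq_card ?orbT //.
  by apply/subsetP => A; rewrite inE => /andP[].
apply: leq_sum => A AS; apply: leq_trans (card_bigcup_le _ _) _.
apply: (@leq_trans (\sum_(B in opp A) 'C(M, t))); first by apply: leq_sum => B; apply: cV.
rewrite sum_nat_const leq_mul2r; apply/orP; right.
apply: leq_trans (_ : b * k * C2 <= _); last by apply: leM; rewrite /b; clear -k0; nia.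
have AF : A \in F by move: AS; rewrite inE => /andP[].
apply: (@card_hit2 T k (opp A) C (fun=> A) k) => //.
- by apply: sub; apply/subsetP => D; rewrite inE => /andP[].
- by move=> _; rewrite cF.
move=> B; rewrite inE => /and4P[BF /eqP ABC /interP[j jB jC] /interP[e eB eA]].
exists j, e; split=> //; apply/eqP => je.
by have : e \in A :&: B :&: C; [rewrite !inE eA eB -je jC | rewrite ABC inE].
Qed.

(** The stars are added one by one; a star shares with the earlier ones only the
    families of sets that contain two points of [C]. *)
Lemma int_count_touching_ge (T : finType) k (C : {set T}) t :
  0 < k -> 0 < t ->
  #|C| * 'C('C(#|T| - 1, k - 1), t) <= int_count (touching k C) t
      + #|C| * 'C(#|C| * 'C(#|T| - 2, k - 2), t).
Proof.
move=> k0 t0; set N := 'C(_ - 1, _); set C2 := 'C(_ - 2, _).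
move: (leqnn #|C|); move: {2}#|C| => b; elim: b C => [|b IH] C.
  by rewrite leqn0 => /eqP ->; rewrite !mul0n.
case: (set_0Vmem C) => [->|[v vC]] cC; first by rewrite cards0 !mul0n.
have cC' := cardsD1 v C; rewrite vC /= in cC'.
have := IH (C :\ v); rewrite -ltnS -add1n -cC' => /(_ cC) IHv.
have CT : touching k (C :\ v) \subset touching k C.
  apply/subsetP => A; rewrite !inE => /andP[-> /interP[x xA /setD1P[_ xC]]] /=.
  by apply/interP; exists x.
have vT : star (kfam T k) v \subset touching k C.
  apply/subsetP => A; rewrite !inE => /andP[-> vA] /=.
  by apply/interP; exists v.
have := int_count_gain t CT vT (star_intersecting _ _); rewrite card_kstar // -/N => gain.
have le : 'C(#|star (kfam T k) v :&: touching k (C :\ v)|, t) <= 'C(#|C| * C2, t).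
  apply: leq_bin2l; apply: (@leq_trans (#|C :\ v| * 1 * C2)); last first.
    by rewrite muln1 leq_mul2r cC' leq_addl orbT.
  apply: (@card_hit2 T k _ (C :\ v) (fun=> [set v]) 1) => //.
  - by apply: subset_trans (subsetIr _ _) (meets_sub _ _).
  - by move=> _; rewrite cards1.
  move=> A; rewrite !inE => /andP[/andP[_ vA] /andP[_ /interP[x xA /setD1P[xv xC]]]].
  by exists x, v; split=> //; rewrite ?inE // xv.
have le2 : #|C :\ v| * 'C(#|C :\ v| * C2, t) <= #|C :\ v| * 'C(#|C| * C2, t).
  rewrite leq_mul2l; apply/orP; right; apply: leq_bin2l.
  by rewrite leq_mul2r cC' leq_addl orbT.
rewrite [X in X * 'C(N, _)]cC' [X in _ <= _ + X * _]cC' !mulnDl !mul1n.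
move: gain le le2 IHv; clear; lia.
Qed.

(** A degree [D] counts as small when [heavy k l * D] is at most the size of a full
    star.  If the largest degree is not small, [heavy_count k l - l] bounds the number
    of points with a degree within a factor [k] of it.  The other two constants bound
    error terms. *)
Definition heavy k l := 32 * l.+1 * k.
Definition heavy_count k l := l + k ^ 2 * l.+1 * heavy k l.
Definition pair_const k l := (heavy_count k l).+1 ^ 2 * k.
Definition star_bound k l :=
  80 * l.+1 * pair_const k l + 8 * (2 + 2 * k * heavy_count k l ^ 2) + heavy k l * k * heavy_count k l.

Lemma error_numeric l m N M t : 0 < M -> m <= l.+1 * N -> 80 * l.+1 * M <= N ->
  4 * ('C(M, t.+2) + m * M * 'C(M, t) + l * 'C(M, t.+2)) <= 'C(N, t.+2).
Proof.
move=> M0 hm hN.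
have h1 : 8 * l.+1 * 'C(M, t.+2) <= 'C(N, t.+2).
  apply: leq_trans (bin_mulKn _ _ _) _; apply: leq_bin2l; nia.
have h2 : 8 * (m * M * 'C(M, t)) <= 'C(N, t.+2).
  have := bin_two (32 * l.+1 * M) (N %/ 2) M t.
  have le : 8 * (m * M) <= 32 * l.+1 * M * (N %/ 2).
    apply: (@leq_trans (8 * (l.+1 * N * M))); first by rewrite leq_mul2l leq_mul2r hm orbT.
    have -> : 32 * l.+1 * M * (N %/ 2) = 8 * (l.+1 * (4 * (N %/ 2)) * M) by lia.
    rewrite leq_mul2l leq_mul2r leq_mul2l; apply/orP; right; apply/orP; right; apply/orP; right.
    have N2 : 2 <= N by nia.
    by lia.
  move=> h; rewrite mulnA; apply: (@leq_trans (32 * l.+1 * M * (N %/ 2) * 'C(M, t))).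
    by rewrite leq_mul2r le orbT.
  apply: leq_trans h _; apply: leq_bin2l.
  have : 40 * l.+1 * M <= N %/ 2 by rewrite leq_divRL // -!mulnA; lia.
  have : M <= l.+1 * M by rewrite leq_pmull.
  move: (l.+1 * M) => z; rewrite -!mulnA; lia.
move: h1 h2; set a := 'C(M, t.+2); set c := m * M * _; set e := 'C(N, _).
have -> : 8 * l.+1 * a = 8 * (l * a) + 8 * a by lia.
lia.
Qed.

Lemma outside_numeric l k m N D t : 1 < N -> m <= l.+1 * N -> heavy k l * D <= N ->
  4 * (m * 'C(k * D, t.+1)) <= 'C(N, t.+2).
Proof.
rewrite /heavy => N1 hm hD.
have h := bin_mul_le (N %/ 2) (N - N %/ 2) 1 t.+1; rewrite bin1 add1n in h.
have e : N %/ 2 + (N - N %/ 2) = N by lia.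
rewrite e in h; apply: leq_trans h.
have h2 : 16 * l.+1 * 'C(k * D, t.+1) <= 'C(N - N %/ 2, t.+1).
  apply: leq_trans (bin_mulKn _ _ _) _; apply: leq_bin2l.
  have -> : 16 * l.+1 * (k * D) = 16 * l.+1 * k * D by lia.
  have : 32 * l.+1 * k * D = 2 * (16 * l.+1 * k * D) by lia.
  lia.
apply: (@leq_trans (N %/ 2 * (16 * l.+1 * 'C(k * D, t.+1)))); last by rewrite leq_mul2l h2 orbT.
rewrite mulnA mulnA leq_mul2r; apply/orP; right.
apply: (@leq_trans (4 * (l.+1 * N))); first by rewrite leq_mul2l hm orbT.
have -> : 4 * (l.+1 * N) = l.+1 * (4 * N) by lia.
have -> : N %/ 2 * (16 * l.+1) = l.+1 * (16 * (N %/ 2)) by lia.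
rewrite leq_mul2l; apply/orP; right; lia.
Qed.

(** Spreading the weight [a * N] of [a] full stars over [q > a] equal stars costs a
    constant factor: the ratio ['C(D, t.+2) / 'C(N, t.+2)] is at most
    [(D / N) ^ 2], and [a ^ 2 / a.+1 <= a - 1 / 2]. *)
Lemma spread_numeric a q D N E t : 0 < a -> a < q -> q * D <= a * N + E -> 8 * E <= N -> D <= N ->
  4 * (q * 'C(D, t.+2)) <= (4 * a - 1) * 'C(N, t.+2).
Proof.
move=> a0 aq hq hE DN.
case: (posnP N) => [N0|Np].
  by move: DN; rewrite N0 leqn0 => /eqP->; rewrite bin0n !muln0.
have r := bin_ratio2 t DN.
have key : 4 * (q * D ^ 2) <= (4 * a - 1) * N ^ 2.
  have h1 : a.+1 * D <= a * N + E by apply: leq_trans hq; rewrite leq_mul2r aq orbT.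
  have h2 : a.+1 * (4 * (q * D ^ 2)) <= 4 * (a * N + E) ^ 2.
    have -> : a.+1 * (4 * (q * D ^ 2)) = 4 * ((q * D) * (a.+1 * D)) by rewrite expnS expn1; lia.
    by rewrite leq_mul2l /= expnS expn1 leq_mul.
  rewrite -(leq_pmul2l (ltn0Sn a)); apply: leq_trans h2 _.
  have h3 : E * N <= N * N by rewrite leq_mul2r; apply/orP; right; lia.
  have h4 : 8 * (E * N) <= N * N by rewrite mulnA leq_mul2r hE orbT.
  have h5 : E * E <= E * N by rewrite leq_mul2l; apply/orP; right; lia.
  have h6 : a * (8 * (E * N)) <= a * (N * N) by rewrite leq_mul2l h4 orbT.
  have h7 : N * N <= a * (N * N) by rewrite leq_pmull.
  have -> : 4 * (a * N + E) ^ 2 = 4 * (a * a * (N * N)) + a * (8 * (E * N)) + 4 * (E * E).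
    by rewrite expnS expn1; lia.
  have e8 : a.+1 * ((4 * a - 1) * N ^ 2) = 4 * (a * a * (N * N)) + 3 * (a * (N * N)) - N * N.
    rewrite expnS expn1; clear -a0; case: a a0 => // a _.
    have -> : 4 * a.+1 - 1 = 4 * a + 3 by lia.
    lia.
  rewrite e8; move: (a * a * (N * N)) (a * (N * N)) (a * (8 * (E * N))) (N * N) (E * N) (E * E) h3 h4 h5 h6 h7; lia.
have N2 : 0 < N ^ 2 by rewrite expn_gt0 Np.
rewrite -(leq_pmul2l N2).
have -> : N ^ 2 * (4 * (q * 'C(D, t.+2))) = 4 * q * (N ^ 2 * 'C(D, t.+2)) by lia.
apply: (@leq_trans (4 * q * (D ^ 2 * 'C(N, t.+2)))); first by rewrite leq_mul2l r orbT.
have -> : 4 * q * (D ^ 2 * 'C(N, t.+2)) = 4 * (q * D ^ 2) * 'C(N, t.+2) by lia.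
by rewrite [X in _ <= X]mulnA leq_mul2r [N ^ 2 * _]mulnC key orbT.
Qed.

(** * Building up one more full star *)

Section Climb.
Variable T : finType.
Variables (k l t best : nat) (C : {set T}) (F : {set {set T}}) (v : T).
Let N := 'C(#|T| - 1, k - 1).
Let C2 := 'C(#|T| - 2, k - 2).
Let D := deg F v.
Hypothesis k1 : 1 < k.
Hypothesis kn : k <= #|T|.
Hypothesis Fk : F \subset kfam T k.
Hypothesis CF : touching k C \subset F.
Hypothesis Cl : #|C| < l.
Hypothesis vC : v \notin C.
Hypothesis Dmax : forall w, w \notin C -> deg F w <= D.
Hypothesis hm : #|F| <= l.+1 * N.
Hypothesis hN : star_bound k l * C2 <= N.
Hypothesis hbest : l * 'C(N, t.+2) <= best + l * 'C(l * C2, t.+2).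

Let C2p : 0 < C2. Proof. by rewrite bin_gt0 leq_sub2r. Qed.

Let k0 : 0 < k. Proof. exact: ltnW. Qed.

Let degN w : deg F w <= N.
Proof.
rewrite /N -(card_kstar w k0); apply: subset_leq_card; exact: starS.
Qed.

Let M := pair_const k l * C2.

Let boundM (C' : {set T}) : #|C'| <= heavy_count k l -> #|C'|.+1 ^ 2 * k * C2 <= M.
Proof.
move=> h; rewrite leq_mul2r /pair_const leq_mul2r leq_sqr ltnS h !orbT //.
Qed.

Let Mp : 0 < M.
Proof. by rewrite muln_gt0 C2p andbT /pair_const muln_gt0 k0 expn_gt0. Qed.

Let MN : 80 * l.+1 * M <= N.
Proof.
apply: leq_trans hN; rewrite mulnA leq_mul2r /star_bound; apply/orP; right.
by rewrite -addnA leq_addr.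
Qed.

Let lC2M : l * C2 <= M.
Proof.
rewrite leq_mul2r; apply/orP; right; rewrite /pair_const /heavy_count.
apply: (@leq_trans (l.+1 ^ 2 * 1)); first by rewrite muln1; clear; nia.
apply: leq_mul => //; rewrite leq_sqr ltnS leq_addr //.
Qed.

Let err := 'C(M, t.+2) + #|F| * M * 'C(M, t) + l * 'C(M, t.+2).
Let errN : 4 * err <= 'C(N, t.+2).
Proof. exact: error_numeric. Qed.

Let hbest' : l * 'C(N, t.+2) <= best + l * 'C(M, t.+2).
Proof.
apply: leq_trans hbest _; rewrite leq_add2l leq_mul2l; apply/orP; right.
exact: leq_bin2l.
Qed.

Let meets_deg A : #|meets (F :\ A) A| <= \sum_(w in A) deg F w.
Proof.
apply: leq_trans (card_bigcup_le _ _); apply: subset_leq_card; apply/subsetP => B.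
rewrite !inE => /andP[/andP[_ BF] /interP[x xB xA]].
by apply/bigcupP; exists x; rewrite // inE BF.
Qed.

(** A set that avoids [C] meets at most [k * D] others, so the families through it
    are negligible; only fewer than [l] stars remain. *)
Lemma int_count_le_of_small_degree : heavy k l * D <= N -> int_count F t.+2 <= best.
Proof.
move=> hD.
have hC : #|C| <= heavy_count k l by rewrite /heavy_count; clear -Cl; lia.
have hx : {in F, forall A, A :&: C == set0 -> #|meets (F :\ A) A| <= k * D}.
  move=> A AF /eqP AC; apply: leq_trans (meets_deg A) _.
  have /eqP <- : #|A| == k by have := subsetP Fk _ AF; rewrite inE.
  rewrite -sum_nat_const; apply: leq_sum => w wA; apply: Dmax.
  by apply/negP => wC; have : w \in A :&: C; [rewrite inE wA | rewrite AC inE].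
have := int_count_stars_le t k0 Fk hx (boundM hC).
have N1 : 1 < N by move: MN Mp; clear; nia.
have h1 := @outside_numeric l k #|F| N D t N1 hm hD.
have h2 : \sum_(i in C) 'C(deg F i, t.+2) <= #|C| * 'C(N, t.+2).
  by rewrite -sum_nat_const; apply: leq_sum => i _; apply: leq_bin2l.
have h3 : #|[set A in F | A :&: C == set0]| * 'C(k * D, t.+1) <= #|F| * 'C(k * D, t.+1).
  by rewrite leq_mul2r subset_leq_card ?orbT //; apply/subsetP => A; rewrite inE => /andP[].
have h4 : #|C| * 'C(N, t.+2) + 'C(N, t.+2) <= l * 'C(N, t.+2).
  by rewrite addnC -mulSn leq_mul2r Cl orbT.
move: h1 h2 h3 h4 hbest' errN; rewrite /err; clear.
lia.
Qed.

Hypothesis DN : D < N.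

(** The exchange pays because the star of [v] is at least as large as the family of
    the sets that meet [A]. *)
Lemma swap_to_max A : A \in F -> A :&: (v |: C) = set0 -> #|meets (F :\ A) A| <= D ->
  exists F' : {set {set T}}, [/\ F' \subset kfam T k, #|F'| = #|F|, touching k C \subset F',
    int_count F t.+2 <= int_count F' t.+2 & D < deg F' v].
Proof.
move=> AF AvC hA.
have [A' A'v A'F] : exists2 A', A' \in star (kfam T k) v & A' \notin F.
  apply/subsetPn; apply/negP => h; move: DN; rewrite ltnNge /N -(card_kstar v k0) /D.
  rewrite subset_leq_card //; apply/subsetP => B Bv; have := Bv; rewrite !inE => /andP[_ ->].
  by rewrite (subsetP h).
move: A'v; rewrite inE => /andP[A'k vA'].
have Ak : #|A| = k by have := subsetP Fk _ AF; rewrite inE => /eqP.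
have vA : v \notin A.
  by apply/negP => vA; have : v \in A :&: (v |: C); [rewrite inE vA setU11 | rewrite AvC inE].
have st : star (F :\ A) v = star F v.
  apply/setP => B; rewrite !inE; case: eqVneq => // ->; by rewrite (negbTE vA) !andbF.
exists (A' |: (F :\ A)); split.
- by rewrite subUset sub1set A'k; apply: subset_trans (subsetDl _ _) Fk.
- by rewrite cardsU1 !inE (negbTE A'F) andbF (cardsD1 A F) AF.
- apply/subsetP => B BC; rewrite !inE (subsetP CF) // andbT; apply/orP; right.
  apply: contraTneq BC => ->; rewrite !inE Ak eqxx /=; apply/negPn; rewrite -subset0 -AvC.
  by apply: setIS; apply: subsetUr.
- apply: (int_count_swap (v := v)) => //; first by rewrite -card_gt0 Ak.
  by rewrite st.
- have -> : star (A' |: (F :\ A)) v = A' |: star F v.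
    apply/setP => B; rewrite -st !inE; case: eqVneq => //= ->; by rewrite vA'.
  by rewrite cardsU1 inE (negbTE A'F) add1n.
Qed.

Hypothesis Dbig : N < heavy k l * D.
Hypothesis stuck : {in F, forall A, A :&: (v |: C) = set0 -> D < #|meets (F :\ A) A|}.
Hypothesis hlow : 'C(#|T|, k) - 'C(#|T| - l, k) <= #|F|.

(** With the factor [k], a set that avoids [C] and has no such point meets at most [D]
    others. *)
Definition heavy_points := [set w | (w \notin C) && (D <= k * deg F w)].
Let H := heavy_points.
Let C' := C :|: H.

Lemma heavy_max : v \in H.
Proof. by rewrite inE vC leq_pmull. Qed.

Lemma heavy_cover : {in F, forall A, A :&: C' != set0}.
Proof.
move=> A AF; apply/negP => /eqP AC'.
have notin x : x \in A -> x \notin C'.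
  by move=> xA; apply/negP => xC; have : x \in A :&: C'; [rewrite inE xA | rewrite AC' inE].
have vH := heavy_max.
have AvC : A :&: (v |: C) = set0.
  apply/eqP; rewrite -subset0 -AC' setIS // subUset subsetUl sub1set inE vH orbT //.
have := stuck AF AvC; rewrite ltnNge => /negP; apply.
apply: leq_trans (meets_deg A) _.
have /eqP Ak : #|A| == k by have := subsetP Fk _ AF; rewrite inE.
rewrite -(leq_pmul2l k0) big_distrr /= -[in X in _ <= X]Ak -sum_nat_const; apply: leq_sum => w wA.
by have := notin _ wA; rewrite !inE negb_or negb_and negbK => /andP[/negbTE-> /=]; rewrite -ltnNge => /ltnW.
Qed.

Lemma heavy_few : #|C'| <= heavy_count k l.
Proof.
apply: leq_trans (leq_of_leqif (leq_card_setU _ _)) _; apply: leq_add; first exact: ltnW.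
have D0 : 0 < D by move: Dbig; case: D => //; rewrite muln0.
rewrite -(leq_pmul2r D0) -sum_nat_const.
apply: (@leq_trans (\sum_(w in H) k * deg F w)).
  by apply: leq_sum => w; rewrite inE => /andP[].
rewrite -big_distrr /=.
apply: (@leq_trans (k * (k * #|F|))).
  rewrite leq_mul2l -(sum_deg Fk) [X in X <= _]big_mkcond /=; apply/orP; right.
  by apply: leq_sum => w _; case: ifP.
apply: (@leq_trans (k * (k * (l.+1 * (heavy k l * D))))).
  rewrite !leq_mul2l; apply/orP; right; apply/orP; right; apply: leq_trans hm _.
  by rewrite leq_mul2l ltnW.
by rewrite expnS expn1 !mulnA.
Qed.

(** With at most [l] points, [C'] could be met by no more than [#|F|] sets, so [F]
    would contain the whole star of [v]. *)
Lemma heavy_many : l < #|C'|.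
Proof.
rewrite ltnNge; apply/negP => gl.
have FC' : F \subset touching k C'.
  by apply/subsetP => A AF; rewrite inE (subsetP Fk) //= heavy_cover.
have e : F = touching k C'.
  apply/eqP; rewrite eqEcard FC' /= card_touching; apply: leq_trans hlow.
  by apply: leq_sub2l; apply: leq_bin2l; apply: leq_sub2l.
move: DN; rewrite ltnNge /N -(card_kstar v k0) /D subset_leq_card //.
apply/subsetP => A; rewrite inE => /andP[Ak vA]; rewrite inE vA andbT e inE Ak /=.
by apply/interP; exists v; rewrite // inE heavy_max orbT.
Qed.

(** Some member of [F] meets [C'] in [w] alone; the more than [D] sets that it meets
    contain [w], except for those with two points in bounded sets. *)
Lemma heavy_tie w : w \in H -> D <= deg F w + k * heavy_count k l * C2.
Proof.
move=> wH; case: (eqVneq w v) => [->|wv]; first exact: leq_addr.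
have [wC dw] : w \notin C /\ D <= k * deg F w by move: wH; rewrite inE => /andP.
pose Mw := [set A in F | (w \in A) && (1 < #|A :&: C'|)].
have cMw : #|Mw| <= heavy_count k l * C2.
  apply: leq_trans (_ : #|[set w]| * #|C'| * C2 <= _); last first.
    by rewrite cards1 mul1n leq_mul2r heavy_few orbT.
  apply: (@card_hit2 T k Mw [set w] (fun=> C') #|C'|) => //.
    by apply: subset_trans Fk; apply/subsetP => A; rewrite inE => /andP[].
  move=> A; rewrite inE => /and3P[AF wA /card_gt1P[a [b [/setIP[aA aC] /setIP[bA bC] ab]]]].
  case: (eqVneq w a) => [wa|wa].
    by exists w, b; split=> //; [apply: set11 | rewrite wa].
  by exists w, a; split=> //; apply: set11.
have lt : #|Mw| < deg F w.
  rewrite ltnNge; apply/negP => h.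
  have : N < N; last by rewrite ltnn.
  apply: leq_trans Dbig _; apply: leq_trans hN.
  apply: (@leq_trans (heavy k l * (k * (heavy_count k l * C2)))).
    rewrite leq_mul2l; apply/orP; right; apply: leq_trans dw _; rewrite leq_mul2l.
    by rewrite (leq_trans h cMw) orbT.
  by rewrite !mulnA leq_mul2r /star_bound leq_addl orbT.
have [A Aw AM] : exists2 A, A \in star F w & A \notin Mw.
  by apply/subsetPn; apply: contraL lt => h; rewrite -leqNgt subset_leq_card.
move: Aw AM; rewrite !inE => /andP[AF wA]; rewrite AF wA /= -leqNgt => A1.
have wC' : w \in C' by rewrite inE wH orbT.
have eA : A :&: C' = [set w].
  apply/eqP; rewrite eq_sym eqEcard sub1set inE wA wC' cards1 A1 //.
have onlyw x : x \in A -> x \in C' -> x = w.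
  by move=> xA xC; have : x \in A :&: C'; [rewrite inE xA | rewrite eA => /set1P].
have AvC : A :&: (v |: C) = set0.
  apply/eqP; rewrite -subset0; apply/subsetP => x /setIP[xA /setU1P[xv|xC]].
    have := onlyw x xA; rewrite inE xv heavy_max orbT => /(_ isT) vw.
    by rewrite vw eqxx in wv.
  have := onlyw x xA; rewrite inE xC => /(_ isT) xw; by rewrite -xw xC in wC.
apply: leq_trans (ltnW (stuck AF AvC)) _.
apply: (@leq_trans #|star F w :|: [set B in F | (w \notin B) && (B :&: A != set0)]|).
  apply: subset_leq_card; apply/subsetP => B; rewrite !inE => /andP[/andP[_ ->] ->] /=.
  by rewrite andbT; case: (w \in B).
apply: leq_trans (leq_of_leqif (leq_card_setU _ _)) _; rewrite leq_add2l.
have /eqP Ak : #|A| == k by have := subsetP Fk _ AF; rewrite inE.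
apply: leq_trans (_ : #|C'| * k * C2 <= _); last first.
  by rewrite leq_mul2r mulnC leq_mul2l heavy_few !orbT.
apply: (@card_hit2 T k _ C' (fun=> A) k) => //; last first.
- move=> B; rewrite inE => /and3P[BF wB /interP[x xB xA]].
  have /interP[y yB yC] := heavy_cover BF.
  exists y, x; split=> //; apply: contraNneq wB => yx.
  by rewrite -(onlyw x) // -yx.
- by move=> _; rewrite Ak.
- by apply: subset_trans Fk; apply/subsetP => B; rewrite inE => /andP[].
Qed.

(** The degrees on [C'] sum to about [l * N], and those outside [C] are almost equal
    and more than [l - #|C|] in number. *)
Lemma int_count_le_of_stuck : 2 < k -> #|F| <= l * N + 2 * C2 -> int_count F t.+2 <= best.
Proof.
move=> k2 hm'; set g0 := heavy_count k l.
have hx : {in F, forall A, A :&: C' == set0 -> #|meets (F :\ A) A| <= 0}.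
  by move=> A AF h; have := heavy_cover AF; rewrite h.
have := int_count_stars_le t k0 Fk hx (boundM heavy_few).
rewrite (_ : [set A in F | _] = set0); last first.
  apply/setP => A; rewrite inE in_set0; apply/negbTE/negP => /andP[AF h].
  by have := heavy_cover AF; rewrite h.
rewrite cards0 mul0n addn0.
have CH : [disjoint C & H].
  rewrite -setI_eq0 -subset0; apply/subsetP => x /setIP[xC]; by rewrite inE xC.
have sum_split (f : T -> nat) : \sum_(i in C') f i = \sum_(i in C) f i + \sum_(i in H) f i.
  by rewrite -bigU //=; apply: eq_bigl => i; rewrite in_setU.
have cC' : #|C'| = #|C| + #|H| by rewrite cardsU disjoint_setI0 // cards0 subn0.
pose E := (2 + 2 * k * g0 ^ 2) * C2.
have dC i : i \in C -> deg F i = N.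
  move=> iC; apply/eqP; rewrite eqn_leq degN /N -(card_kstar i k0) subset_leq_card //.
  apply/subsetP => A; rewrite !inE => /andP[Ak iA]; rewrite iA andbT.
  by apply: (subsetP CF); rewrite !inE Ak; apply/interP; exists i.
have sumC : \sum_(i in C') deg F i <= #|F| + k * (g0 * g0 * C2).
  pose Ma := [set A in F | 1 < #|A :&: C'|].
  have cMa : #|Ma| <= g0 * g0 * C2.
    apply: leq_trans (_ : #|C'| * #|C'| * C2 <= _); last first.
      by rewrite leq_mul2r leq_mul ?orbT // heavy_few.
    apply: (@card_hit2 T k Ma C' (fun=> C') #|C'|) => //.
      by apply: subset_trans Fk; apply/subsetP => A; rewrite inE => /andP[].
    move=> A; rewrite inE => /andP[AF /card_gt1P[a [b [/setIP[aA aC] /setIP[bA bC] ab]]]].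
    by exists a, b.
  have -> : \sum_(i in C') deg F i = \sum_(A in F) #|A :&: C'|.
    transitivity (\sum_(i in C') \sum_(A in F) (i \in A : nat)).
      apply: eq_bigr => w _; rewrite -sum1_card big_mkcond [RHS]big_mkcond /=.
      by apply: eq_bigr => A _; rewrite inE; case: (A \in F); case: (w \in A).
    rewrite exchange_big /=; apply: eq_bigr => A AF.
    rewrite -sum1_card big_mkcond [RHS]big_mkcond /=; apply: eq_bigr => w _.
    by rewrite in_setI; case: (w \in A); case: (w \in C').
  apply: (@leq_trans (\sum_(A in F) (1 + k * (A \in Ma)))).
    apply: leq_sum => A AF; rewrite [A \in Ma]inE AF /=; case: ltnP => h.
      have /eqP <- : #|A| == k by have := subsetP Fk _ AF; rewrite inE.
      by rewrite muln1 ltnW // ltnS subset_leq_card // subsetIl.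
    by rewrite muln0 addn0.
  rewrite big_split /= sum1_card leq_add2l -big_distrr /= leq_mul2l; apply/orP; right.
  apply: leq_trans cMa; rewrite -sum1_card [X in _ <= X]big_mkcond /= [X in X <= _]big_mkcond /=.
  by apply: leq_sum => A _; case: (A \in F); case: (A \in Ma).
have qD : #|H| * D <= (l - #|C|) * N + E.
  have h1 : #|H| * D <= \sum_(i in H) deg F i + #|H| * (k * g0 * C2).
    rewrite -!sum_nat_const -big_split /=; apply: leq_sum => w; exact: heavy_tie.
  have h2 : \sum_(i in C) deg F i = #|C| * N by rewrite -sum_nat_const; apply: eq_bigr.
  have h3 : #|H| * (k * g0 * C2) <= g0 * (k * g0 * C2).
    by rewrite leq_mul2r; apply/orP; right; apply: leq_trans heavy_few; rewrite cC' leq_addl.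
  have h4 : #|C| * N + (l - #|C|) * N = l * N by rewrite -mulnDl subnKC // ltnW.
  rewrite sum_split h2 in sumC.
  have -> : E = 2 * C2 + k * (g0 * g0 * C2) + g0 * (k * g0 * C2) by rewrite /E; clear; lia.
  move: h1 h3 h4 sumC hm'.
  clear; lia.
have E8 : 8 * E <= N.
  apply: leq_trans hN; rewrite /E mulnA leq_mul2r /star_bound -/g0; apply/orP; right.
  by rewrite addnAC leq_addl.
have aq : l - #|C| < #|H| by have := heavy_many; rewrite cC'; clear -Cl; lia.
have a0 : 0 < l - #|C| by rewrite subn_gt0.
have num := @spread_numeric (l - #|C|) #|H| D N E t a0 aq qD E8 (ltnW DN).
have s1 : \sum_(i in C') 'C(deg F i, t.+2) <= #|C| * 'C(N, t.+2) + #|H| * 'C(D, t.+2).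
  rewrite sum_split; apply: leq_add; rewrite -sum_nat_const; apply: leq_sum => i iC; apply: leq_bin2l => //.
  by apply: Dmax; move: iC; rewrite inE => /andP[].
have s2 : 4 * (#|C| * 'C(N, t.+2)) + ((4 * (l - #|C|) - 1) * 'C(N, t.+2) + 'C(N, t.+2)) = 4 * (l * 'C(N, t.+2)).
  have e4 : 4 * (l - #|C|) - 1 + 1 = 4 * (l - #|C|) by clear -a0; lia.
  rewrite -[X in _ + (_ + X)]mul1n -mulnDl e4 -mulnA -mulnDr -mulnDl subnKC //.
  exact: ltnW.
move: num s1 s2 hbest' errN; rewrite /err; clear.
lia.
Qed.

End Climb.

(** * Graphs *)

Section Graph.
Variable T : finType.
Implicit Types (F G : {set {set T}}) (A B : {set T}) (x y z v w h : T).

Lemma edge_eq F A x y : F \subset kfam T 2 -> A \in F -> x \in A -> y \in A -> x != y -> A = [set x; y].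
Proof.
move=> Fk AF xA yA xy; apply/eqP; rewrite eq_sym eqEcard subUset !sub1set xA yA cards2 xy /=.
by have := subsetP Fk _ AF; rewrite inE => /eqP->.
Qed.

Lemma set2_inj x y z : x != y -> [set x; y] = [set x; z] -> y = z.
Proof.
move=> xy e; have : y \in [set x; z] by rewrite -e set22.
by rewrite !inE eq_sym (negbTE xy) => /eqP.
Qed.

Lemma stars_disjoint F x y : F \subset kfam T 2 -> x != y -> [set x; y] \notin F ->
  star F x :&: star F y = set0.
Proof.
move=> Fk xy eF; apply/eqP; rewrite -subset0; apply/subsetP => A.
rewrite !inE => /andP[/andP[AF xA] /andP[_ yA]].
by rewrite -(edge_eq Fk AF xA yA xy) AF in eF.
Qed.

Lemma int_count_meets_edge_ge F x y s : F \subset kfam T 2 -> x != y -> [set x; y] \notin F ->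
  'C(deg F x, s.+1) + 'C(deg F y, s.+1) <= int_count (meets F [set x; y]) s.+1.
Proof.
move=> Fk xy eF.
have hx : star F x \subset meets F [set x; y] by apply: star_meets; rewrite set21.
have hy : star F y \subset meets F [set x; y] by apply: star_meets; rewrite set22.
have := int_count_gain s.+1 hx hy (star_intersecting F y).
by rewrite setIC (stars_disjoint Fk xy eF) cards0 bin0n addn0 int_count_intersecting // star_intersecting.
Qed.

(** An intersecting family of edges is a star or a triangle. *)
Lemma int_count_meets_edge_le F x y s : F \subset kfam T 2 -> x != y -> [set x; y] \notin F ->
  int_count (meets F [set x; y]) s.+1 <=
    'C(deg F x, s.+1) + 'C(deg F y, s.+1) + (s == 1) * deg F y.
Proof.
move=> Fk xy eF.
pose P (Z : {set {set T}}) := [set G : {set {set T}} | (G \subset Z) && (#|G| == s.+1)].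
pose tri := [set [set A; x |: (A :\ y)] | A in star F y].
have cov : intfams (meets F [set x; y]) s.+1 \subset
    P (star F x) :|: P (star F y) :|: (if s == 1 then tri else set0).
  apply/subsetP => G; rewrite inE => /and3P[/subsetP GF Gs /intersectingP Gi].
  rewrite !in_setU.
  case: (boolP (G \subset star F x)) => Gx; first by rewrite [G \in P _]inE Gx Gs.
  case: (boolP (G \subset star F y)) => Gy; first by rewrite [G \in P (star F y)]inE Gy Gs orbT.
  have inF A : A \in G -> A \in F /\ (x \in A \/ y \in A).
    move=> /GF; rewrite inE => /andP[AF /interP[u uA /set2P[] <-]]; split=> //; [by left|by right].
  have [A AG Ax] := subsetPn Gx; have [B BG By] := subsetPn Gy.
  have [AF Axy] := inF _ AG; have [BF Bxy] := inF _ BG.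
  have xA : x \notin A by move: Ax; rewrite inE AF.
  have yB : y \notin B by move: By; rewrite inE BF.
  have yA : y \in A by case: Axy => // h; rewrite h in xA.
  have xB : x \in B by case: Bxy => // h; rewrite h in yB.
  have [w wA wB] := interP _ _ (Gi _ _ AG BG).
  have wx : w != x by apply: contraNneq xA => <-.
  have wy : w != y by apply: contraNneq yB => <-.
  have eA : A = [set y; w] by apply: (edge_eq Fk); rewrite // eq_sym.
  have eB : B = [set x; w] by apply: (edge_eq Fk); rewrite // eq_sym.
  have eG : G = [set A; B].
    apply/setP => E; apply/idP/set2P => [EG|[]->//].
    have [EF Exy] := inF _ EG.
    have xyE : x \in E -> y \in E -> False.
      by move=> xE yE; rewrite -(edge_eq Fk EF xE yE xy) EF in eF.
    case: Exy => [xE|yE].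
      right; have [u uE uA] := interP _ _ (Gi _ _ EG AG).
      move: uA; rewrite eA => /set2P[] eu; first by case: xyE; rewrite // -eu.
      by rewrite eB; apply: (edge_eq Fk); rewrite // -?eu // eq_sym eu.
    left; have [u uE uB] := interP _ _ (Gi _ _ EG BG).
    move: uB; rewrite eB => /set2P[] eu; first by case: xyE; rewrite // -eu.
    by rewrite eA; apply: (edge_eq Fk); rewrite // -?eu // eq_sym eu.
  have AB : A != B by apply: contraNneq yB => <-.
  have s1 : s == 1 by move: Gs; rewrite eG cards2 AB eqSS eq_sym.
  apply/orP; right; rewrite s1; apply/imsetP; exists A; first by rewrite inE AF yA.
  rewrite eG; congr [set _; _]; rewrite eB eA; apply/setP => u; rewrite !inE.
  by case: (eqVneq u y) => //= ->; rewrite orbF eq_sym (negbTE xy) /= eq_sym (negbTE wy).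
rewrite int_countE; apply: leq_trans (subset_leq_card cov) _.
apply: leq_trans (leq_of_leqif (leq_card_setU _ _)) _; apply: leq_add.
  by apply: leq_trans (leq_of_leqif (leq_card_setU _ _)) _; rewrite !cards_draws.
by case: ifP => _; rewrite ?cards0 // mul1n leq_imset_card.
Qed.

Lemma deg_setU1 F x y : x != y -> [set x; y] \notin F ->
  deg ([set x; y] |: F) x = (deg F x).+1.
Proof.
move=> xy eF; rewrite (_ : star _ x = [set x; y] |: star F x).
  by rewrite cardsU1 inE (negbTE eF).
by apply/setP => A; rewrite !inE; case: eqVneq => //= ->; rewrite set21.
Qed.

Lemma deg_setD1 F x y : [set x; y] \in F -> (deg (F :\ [set x; y]) x).+1 = deg F x.
Proof.
move=> eF; rewrite [in RHS](cardsD1 [set x; y]) inE eF set21 add1n; congr _.+1.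
by apply: eq_card => A; rewrite !inE andbA.
Qed.

(** The edges are deleted one at a time, so the degree of [h] drops at each step. *)
Lemma int_count_delete_edges F h (Y : {set T}) g s : F \subset kfam T 2 ->
  {in Y, forall y, [/\ [set h; y] \in F, h != y & deg F y <= g]} ->
  int_count F s.+2 <= int_count (F :\: [set [set h; y] | y in Y]) s.+2
    + \sum_(a < #|Y|) ('C(deg F h - a.+1, s.+1) + 'C(g.-1, s.+1) + (s == 1) * g.-1).
Proof.
move En: #|Y| => n; elim: n Y F En => [|n IH] Y F En Fk hY.
  by rewrite (cards0_eq En) imset0 setD0 leq_addr.
have [y yY] : exists y, y \in Y by apply/set0Pn; rewrite -card_gt0 En.
have [eF hy dy] := hY _ yY; set e := [set h; y] in eF.
have En' : #|Y :\ y| = n by have := cardsD1 y Y; rewrite yY En; lia.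
have Fk' : F :\ e \subset kfam T 2 by apply: subset_trans (subsetDl _ _) Fk.
have dh := deg_setD1 eF.
have := IH (Y :\ y) (F :\ e) En' Fk'.
have -> : F :\ e :\: [set [set h; y0] | y0 in Y :\ y] = F :\: [set [set h; y0] | y0 in Y].
  by rewrite -{2}(setD1K yY) imsetU1 setDDl.
move=> IHF; rewrite big_ord_recl /=.
have e0 : e != set0 by apply/set0Pn; exists h; rewrite set21.
rewrite -{1}(setD1K eF) int_countU1 ?setD11 //.
have := @int_count_meets_edge_le (F :\ e) h y s Fk' hy (negbT (setD11 _ _)).
have dy' : deg (F :\ e) y <= g.-1.
  by rewrite -ltnS; apply: leq_trans (_ : g <= _); [rewrite /e setUC deg_setD1 // setUC|lia].
have -> : deg F h - 1 = deg (F :\ e) h by rewrite -dh subn1.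
have le1 := leq_bin2l s.+1 dy'.
have le2 : (s == 1) * deg (F :\ e) y <= (s == 1) * g.-1 by rewrite leq_mul2l dy' orbT.
have := IHF _; have -> : \sum_(i < n) ('C(deg F h - (bump 0 i).+1, s.+1) + 'C(g.-1, s.+1) + (s == 1) * g.-1)
   = \sum_(a < n) ('C(deg (F :\ e) h - a.+1, s.+1) + 'C(g.-1, s.+1) + (s == 1) * g.-1).
  by apply: eq_bigr => i _; rewrite -dh /bump /= add1n.
move=> IHF' up; have {}IHF := IHF' _.
have hY' : {in Y :\ y, forall y0, [/\ [set h; y0] \in F :\ e, h != y0 & deg (F :\ e) y0 <= g]}.
  move=> y0 /setD1P[y0y y0Y]; have [y0F hy0 dy0] := hY _ y0Y; split=> //.
    by rewrite in_setD1 y0F andbT; apply: contra y0y => /eqP/(set2_inj hy0)/eqP.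
  by apply: leq_trans dy0; apply: subset_leq_card; apply: starS; apply: subsetDl.
have arith (m c1 c2 c3 q' q x y' S : nat) : m <= c1 + c2 + q' -> c2 <= c3 -> q' <= q ->
    x <= y' + S -> x + m <= y' + (c1 + c3 + q + S) by clear; lia.
exact: arith up le1 le2 (IHF hY').
Qed.

Lemma int_count_insert_edges F z (I : {set T}) d s : F \subset kfam T 2 ->
  {in I, forall i, [/\ [set i; z] \notin F, i != z & d <= deg F i]} ->
  int_count F s.+2 + \sum_(a < #|I|) ('C(d, s.+1) + 'C(deg F z + a, s.+1))
    <= int_count (F :|: [set [set i; z] | i in I]) s.+2.
Proof.
move En: #|I| => n; elim: n I F En => [|n IH] I F En Fk hI.
  by rewrite (cards0_eq En) imset0 setU0 big_ord0 addn0.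
have [i iI] : exists i, i \in I by apply/set0Pn; rewrite -card_gt0 En.
have [eF iz di] := hI _ iI; set e := [set i; z] in eF.
have En' : #|I :\ i| = n by have := cardsD1 i I; rewrite iI En; lia.
have Fk' : e |: F \subset kfam T 2 by rewrite subUset Fk sub1set inE cards2 iz.
have e0 : e != set0 by apply/set0Pn; exists i; rewrite set21.
have dz : deg (e |: F) z = (deg F z).+1.
  by rewrite /e [[set i; z]]setUC deg_setU1 // 1?eq_sym // setUC.
have hI' : {in I :\ i, forall i0, [/\ [set i0; z] \notin e |: F, i0 != z & d <= deg (e |: F) i0]}.
  move=> i0 /setD1P[i0i i0I]; have [i0F i0z di0] := hI _ i0I; split=> //.
    rewrite in_setU1 negb_or i0F andbT; apply: contra i0i => /eqP.
    by rewrite /e [[set i0; z]]setUC [[set i; z]]setUC eq_sym => /(set2_inj _)->; rewrite // eq_sym.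
  by apply: leq_trans di0 _; apply: subset_leq_card; apply: starS; apply: subsetUr.
have := IH (I :\ i) (e |: F) En' Fk' hI'.
have -> : e |: F :|: [set [set i0; z] | i0 in I :\ i] = F :|: [set [set i0; z] | i0 in I].
  by rewrite -{2}(setD1K iI) imsetU1 setUA [e |: F]setUC.
rewrite int_countU1 // big_ord_recl /= addn0 => IHF.
have arith (x m c c' c2 S S' r : nat) : S' = S -> c <= c' -> c' + c2 <= m ->
    x + m + S <= r -> x + (c + c2 + S') <= r by clear; lia.
apply: arith (leq_bin2l s.+1 di) (int_count_meets_edge_ge s Fk iz eF) IHF.
by apply: eq_bigr => a _; rewrite dz /bump /= add1n addSnnS.
Qed.

(** For [s = 0] the two sides are linear and the inequality may be tight: the losses
    [d - a.+1] decrease while the gains [dz + a] increase, so they are matched in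
    opposite order.  For larger [s] the first step already gains
    ['C(d.-1, s)], more than all the lower-order terms. *)
Lemma move_numeric d g c dz s : g ^ 2 < d -> c <= g -> g.-1 <= dz + c ->
  \sum_(a < c) ('C(d - a.+1, s.+1) + 'C(g.-1, s.+1) + (s == 1) * g.-1)
  <= \sum_(a < c) ('C(d, s.+1) + 'C(dz + a, s.+1)).
Proof.
move=> gd cg hz; have gd' : g * g < d by move: gd; rewrite expnS expn1.
case: s => [|s].
  rewrite big_split [X in _ <= X]big_split /= (reindex_inj rev_ord_inj) /= -[X in _ <= X]addn0.
  rewrite addn0 -!big_split; apply: leq_sum => a _ /=; rewrite !bin1 mul0n addn0.
  by have := ltn_ord a; nia.
apply: leq_sum => a _; apply: leq_trans (leq_addr _ _).
have -> : d = d.-1.+1 by lia.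
rewrite [X in _ <= X]binS subSS.
have le1 : 'C(d.-1 - a, s.+2) <= 'C(d.-1, s.+2) by apply: leq_bin2l; apply: leq_subr.
rewrite -addnA; apply: leq_add => //.
have gd2 : g.-1 * g.-1 + g.-1 <= d.-1 by nia.
case: s {le1} => [|s] /=.
  rewrite mul1n bin1; have := binS_le g.-1 1; rewrite bin1; lia.
rewrite mul0n addn0; apply: leq_trans (binS_le _ _) _; apply: leq_trans (bin_mulKn _ _ _) _.
apply: leq_bin2l; lia.
Qed.

(** The edges from [h] to [Y] are replaced by the edges from [I] to [z].  Moving a
    single edge may lose when all large degrees are equal; filling up the
    neighbourhood of [z] makes its own degree contribute as well. *)
Lemma move_edges F (C I Y : {set T}) h z v g t : F \subset kfam T 2 -> touching 2 C \subset F ->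
  h \notin C -> v \in I -> #|Y| = #|I| -> #|I| <= g -> g ^ 2 < deg F h ->
  g.-1 <= deg (F :\: [set [set h; y] | y in Y]) z + #|I| ->
  {in Y, forall y, [/\ [set h; y] \in F, h != y, deg F y <= g & y \notin C :|: I]} ->
  {in I, forall i, [/\ [set i; z] \notin F, i != z, i != h & deg F h <= deg F i]} ->
  exists F' : {set {set T}}, [/\ F' \subset kfam T 2, #|F'| = #|F|, touching 2 C \subset F',
    int_count F t.+2 <= int_count F' t.+2 & deg F v < deg F' v].
Proof.
move=> Fk CF hC vI YI Ig gd gz hY hI.
pose Rm := [set [set h; y] | y in Y]; pose Ad := [set [set i; z] | i in I].
have RF : Rm \subset F by apply/subsetP => A /imsetP[y /hY[yF _ _ _] ->].
have F0k : F :\: Rm \subset kfam T 2 by apply: subset_trans (subsetDl _ _) Fk.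
have stI i : i \in I -> star (F :\: Rm) i = star F i.
  move=> iI; have [_ _ ih _] := hI _ iI; apply/setP => A; rewrite !inE -andbA.
  case: (boolP (A \in Rm)) => //= /imsetP[y yY ->].
  have [_ _ _] := hY _ yY; rewrite inE negb_or => /andP[_ yI].
  rewrite !inE (negbTE ih) /=; case: eqVneq => [iy|]; last by rewrite andbF.
  by rewrite -iy iI in yI.
have AdF A : A \in Ad -> A \notin F by case/imsetP => i /hI[iF _ _ _] ->.
exists ((F :\: Rm) :|: Ad); split.
- rewrite subUset F0k; apply/subsetP => A /imsetP[i /hI[_ iz _ _] ->].
  by rewrite inE cards2 iz.
- have cRm : #|Rm| = #|Y|.
    apply: card_in_imset => y y' yY y'Y; apply: set2_inj; by have [] := hY _ yY.
  have cAd : #|Ad| = #|I|.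
    apply: card_in_imset => i i' iI i'I /=; rewrite ![[set _; z]]setUC => /set2_inj; apply.
    by rewrite eq_sym; have [] := hI _ iI.
  have d : (F :\: Rm) :&: Ad = set0.
    apply/eqP; rewrite -subset0; apply/subsetP => A /setIP[/setDP[AF _] /AdF]; by rewrite AF.
  rewrite cardsU d cards0 subn0 cardsD (setIidPr RF) cRm cAd YI subnK //.
  by rewrite -YI -cRm; apply: subset_leq_card.
- apply/subsetP => A AC; rewrite in_setU in_setD (subsetP CF) // andbT; apply/orP; left.
  apply/negP => /imsetP[y yY eA]; move: AC; rewrite inE eA => /andP[_ /interP[x /set2P[]-> xC]].
    by rewrite xC in hC.
  by have [_ _ _] := hY _ yY; rewrite inE xC.
- have hY' : {in Y, forall y, [/\ [set h; y] \in F, h != y & deg F y <= g]}.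
    by move=> y /hY[].
  have hI' : {in I, forall i, [/\ [set i; z] \notin F :\: Rm, i != z & deg F h <= deg (F :\: Rm) i]}.
    move=> i iI; rewrite (stI _ iI); have [iF iz _ di] := hI _ iI; split=> //.
    by rewrite in_setD (negbTE iF) andbF.
  have l1 := int_count_delete_edges t Fk hY'.
  have l2 := int_count_insert_edges t F0k hI'.
  have l3 := @move_numeric (deg F h) g #|I| (deg (F :\: Rm) z) t gd Ig gz.
  rewrite YI in l1; apply: leq_trans l1 _; apply: leq_trans l2; by rewrite leq_add2l.
have [vF vz vh _] := hI _ vI.
apply: (@leq_trans #|[set v; z] |: star F v|); first by rewrite cardsU1 inE (negbTE vF).
apply: subset_leq_card; rewrite subUset sub1set; apply/andP; split.
  rewrite [_ \in star _ _]inE; apply/andP; split; last exact: set21.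
  by apply/setUP; right; apply/imsetP; exists v.
by rewrite -(stI _ vI); apply: starS; apply: subsetUl.
Qed.

End Graph.

(** Among the heavy points other than [v], take [h] of least degree, and let [z] be
    a non-neighbour of [v].  If [z] is heavy, one edge is moved.  If not, [z] is
    joined to all the heavy points but [h] that it misses; as all edges meet the
    cover, the final degree of [z] is then at least what remains at the other ends of
    the deleted edges. *)
Lemma graph_climb (T : finType) (F : {set {set T}}) (C H : {set T}) v t :
  F \subset kfam T 2 -> touching 2 C \subset F -> C :&: H = set0 -> v \in H ->
  {in F, forall A, A :&: (C :|: H) != set0} -> 1 < #|H| ->
  (forall w, w \notin C -> deg F w <= deg F v) -> deg F v < #|T| - 1 ->
  {in H, forall w, #|C :|: H| ^ 2 + 2 * #|C :|: H| + 2 <= deg F w} ->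
  exists F' : {set {set T}}, [/\ F' \subset kfam T 2, #|F'| = #|F|, touching 2 C \subset F',
    int_count F t.+2 <= int_count F' t.+2 & deg F v < deg F' v].
Proof.
move=> Fk CF CH vH cover H2 vmax vN big.
set C' := C :|: H in cover big *; pose g := #|C'|; rewrite -/g in big.
have HnC x : x \in H -> x \notin C.
  by move=> xH; apply/negP => xC; have : x \in C :&: H; [rewrite inE xC | rewrite CH inE].
have HC' x : x \in H -> x \in C' by move=> xH; rewrite inE xH orbT.
have [h0 h0H] : exists h0, h0 \in H :\ v.
  by apply/set0Pn; rewrite -card_gt0; have := cardsD1 v H; rewrite vH; lia.
have [h hHv hmin] := @arg_minnP _ h0 (mem (H :\ v)) (fun w => deg F w) h0H.
have {hHv} [hv hH] : h != v /\ h \in H by move: hHv => /=; rewrite !inE => /andP.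
have minH w : w \in H -> deg F h <= deg F w.
  move=> wH; case: (eqVneq w v) => [->|wv]; first by apply: vmax; apply: HnC.
  by apply: hmin; rewrite /= !inE wv.
have bigh := big _ hH.
have degout y : y \notin C' -> deg F y <= g.
  move=> yC'; apply: (@leq_trans #|[set [set y; c] | c in C']|); last exact: leq_imset_card.
  apply: subset_leq_card; apply/subsetP => A; rewrite inE => /andP[AF yA].
  have [c cA cC'] := interP _ _ (cover _ AF).
  apply/imsetP; exists c => //; apply: (edge_eq Fk) => //.
  by apply: contraNneq yC' => ->.
have [z vz zF] : exists2 z, v != z & [set v; z] \notin F.
  apply/exists_inP; apply: contraLR vN; rewrite negb_exists_in -leqNgt => /forall_inP h1.
  have inj : {in [set~ v] &, injective (fun z => [set v; z])}.
    by move=> z z'; rewrite !inE => zv _ /set2_inj; apply; rewrite eq_sym.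
  have <- : #|[set~ v]| = #|T| - 1 by rewrite cardsC1 subn1.
  rewrite -(card_in_imset inj); apply: subset_leq_card; apply/subsetP => A /imsetP[z].
  rewrite !inE => zv ->; rewrite set21 andbT; apply/negPn; apply: h1; by rewrite eq_sym.
have CFe i w : i \in C -> i != w -> [set i; w] \in F.
  move=> iC iw; apply: (subsetP CF); rewrite !inE cards2 iw eqxx /=.
  by apply/interP; exists i; rewrite // set21.
have zC : z \notin C by apply: contra zF => zC; rewrite setUC CFe // eq_sym.
pose N0 := [set y | [&& [set h; y] \in F, h != y, y \notin C' & y != z]].
have cN0 : deg F h <= #|N0| + g + 1.
  apply: (@leq_trans #|[set [set h; y] | y in N0 :|: C' :|: [set z]]|).
    apply: subset_leq_card; apply/subsetP => A; rewrite inE => /andP[AF hA].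
    have Ak : #|A| = 2 by have := subsetP Fk _ AF; rewrite inE => /eqP.
    have /card_gt0P[y] : 0 < #|A :\ h| by move: Ak; rewrite (cardsD1 h A) hA add1n => -[->].
    rewrite !inE => /andP[yh yA]; have hy : h != y by rewrite eq_sym.
    have eA := edge_eq Fk AF hA yA hy; apply/imsetP; exists y => //.
    rewrite !in_setU in_set1 [y \in N0]inE -eA AF hy /= -in_setU.
    by case: (y \in C') => //; case: (y == z).
  apply: leq_trans (leq_imset_card _ _) _.
  apply: leq_trans (leq_of_leqif (leq_card_setU _ _)) _; rewrite cards1 leq_add2r.
  exact: leq_of_leqif (leq_card_setU _ _).
have g1 : g ^ 2 < deg F h by apply: leq_trans bigh; clear; lia.
have pickY c : c <= g -> exists2 Y : {set T}, Y \subset N0 & #|Y| = c.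
  by move=> cg; apply: subset_of_card; move: cN0 bigh cg; clear; lia.
have vC' := HC' _ vH.
have YN0 (I Y : {set T}) : Y \subset N0 -> I \subset C' ->
    {in Y, forall y, [/\ [set h; y] \in F, h != y, deg F y <= g & y \notin C :|: I]}.
  move=> /subsetP YN IC y /YN; rewrite inE => /and4P[yF hy yC' yz]; split=> //; first exact: degout.
  by apply: contra yC' => /setUP[yC|/(subsetP IC)//]; rewrite inE yC.
case: (boolP (z \in C')) => zC'.
  have zH : z \in H by move: zC'; rewrite inE (negbTE zC).
  have [|Y YN cY] := pickY 1; first by rewrite card_gt0; apply/set0Pn; exists v.
  apply: (@move_edges T F C [set v] Y h z v g t) => //; rewrite ?cards1 ?set11 ?cY //.
  - exact: HnC.
  - by rewrite card_gt0; apply/set0Pn; exists v.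
  - have le : deg F z <= deg (F :\: [set [set h; y] | y in Y]) z + 1.
      set Rm := [set _ | _ in Y].
      apply: (@leq_trans (deg (F :\: Rm) z + #|Rm|)); last first.
        by rewrite leq_add2l -cY leq_imset_card.
      apply: leq_trans (leq_of_leqif (leq_card_setU _ _)); apply: subset_leq_card.
      apply/subsetP => A; rewrite !inE => /andP[-> ->]; rewrite !andbT; by case: (_ \in _).
    apply: leq_trans le; have := big _ zH; clear; lia.
  - by apply: YN0 => //; rewrite sub1set.
  - by move=> i /set1P ->; split=> //; [rewrite eq_sym | apply: minH].
pose Nz := [set i in C' | [set i; z] \notin F].
have NzH i : i \in Nz -> i \in H.
  rewrite inE => /andP[iC' iF]; move: (iC'); rewrite inE => /orP[iC|//].
  by case/negP: iF; apply: CFe => //; apply: contraNneq zC => <-.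
have sz : #|Nz :\ h| <= g.
  apply: subset_leq_card; apply/subsetP => i; rewrite !in_setD1 => /andP[_].
  by rewrite inE => /andP[].
have [Y YN cY] := pickY _ sz.
have IC' : Nz :\ h \subset C'.
  by apply/subsetP => i; rewrite in_setD1 => /andP[_ /NzH/HC'].
apply: (@move_edges T F C (Nz :\ h) Y h z v g t) => //.
- exact: HnC.
- by rewrite in_setD1 eq_sym hv inE vC'.
- have le : #|C' :\: Nz| <= deg (F :\: [set [set h; y] | y in Y]) z.
    apply: (@leq_card_imset_inj _ _ (fun i => [set z; i])).
      move=> i i'; rewrite in_setD => /andP[_ iC'] _; apply: set2_inj.
      by apply: contraNneq zC' => ->.
    move=> i; rewrite !in_setD [i \in Nz]inE => /andP[h1 iC']; rewrite iC' /= negbK in h1.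
    rewrite inE set21 andbT in_setD setUC h1 andbT.
    apply/negP => /imsetP[y yY e].
    have : z \in [set h; y] by rewrite -e set22.
    have := subsetP YN _ yY; rewrite inE => /and4P[_ _ _ yz].
    case/set2P => [zh|zy]; last by rewrite zy eqxx in yz.
    by move: zC'; rewrite zh HC'.
  have e1 : #|C' :\: Nz| + #|Nz| = g.
    rewrite /g -[in RHS](cardsID Nz C') addnC; congr (_ + _).
    by congr #|pred_of_set _|; apply/esym/setIidPr; apply/subsetP => i /NzH/HC'.
  have e2 := cardsD1 h Nz; move: le e1 e2; clear.
  by case: (h \in Nz); lia.
- exact: YN0.
- move=> i; rewrite in_setD1 => /andP[ih iN]; have iH := NzH _ iN.
  split=> //; [|by apply: contraNneq zC' => <-; apply: HC'|exact: minH].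
  by move: iN; rewrite inE => /andP[].
Qed.

(** * The theorem *)

(** Least degree of the heavy points required by [graph_climb] for a cover of [g]
    points. *)
Definition graph_bound g := g ^ 2 + 2 * g + 2.

Definition lex_threshold k l :=
  full_bound k l + k * star_bound k l
  + 2 * heavy k l * graph_bound (heavy_count k l) + k + l + 5.

Section Main.
Variables (n k l t m : nat).
Let N := 'C(n - 1, k - 1).
Let C2 := 'C(n - 2, k - 2).
Hypothesis k1 : 1 < k.
Hypothesis l0 : 0 < l.
Hypothesis nbig : lex_threshold k l <= n.
Hypothesis mlow : 'C(n, k) - 'C(n - l, k) <= m.
Hypothesis mhigh : m <= 'C(n, k) - 'C(n - l, k) + (n - l - k + 1).
Let best := int_count (lex_family n k m) t.+2.

Let k0 : 0 < k. Proof. exact: ltnW. Qed.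
Let lkn : l + k + 5 <= n.
Proof. by apply: leq_trans nbig; rewrite /lex_threshold; clear; lia. Qed.

Let hstar : star_bound k l * C2 <= N.
Proof.
have h := @bin_dominate (star_bound k l) 0 (n - 2) (k - 2).
have e1 : (n - 2).+1 - 0 = n - 1 by clear -lkn; lia.
have e2 : (k - 2).+1 = k - 1 by clear -k1; lia.
rewrite e1 e2 in h; apply: h; rewrite addn0.
apply: (@leq_trans (k * star_bound k l)); first by rewrite leq_mul2r leq_subr orbT.
by move: nbig; rewrite /lex_threshold; clear; lia.
Qed.

Let nN : n - 1 <= N.
Proof. apply: leq_bin_self; clear -k1 lkn; lia. Qed.

Let low_linear : 'C(n, k) - 'C(n - l, k) <= l * N.
Proof.
have [|L _ cL] := @subset_of_card _ [set: 'I_n] l.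
  by rewrite cardsT card_ord; clear -lkn; lia.
by have := @card_touching_le 'I_n k L k0; rewrite card_touching card_ord cL.
Qed.

Let m_linear : m <= l * N + n.
Proof.
apply: leq_trans mhigh _; apply: leq_add; last by clear -lkn k1; lia.
exact: low_linear.
Qed.

Let m_stars : m <= l.+1 * N.
Proof.
apply: leq_trans mhigh _; rewrite mulSn addnC; apply: leq_add.
  by apply: leq_trans nN; clear -lkn k1; lia.
exact: low_linear.
Qed.

Let best_stars : l * 'C(N, t.+2) <= best + l * 'C(l * C2, t.+2).
Proof.
have lk : l + k <= n by clear -lkn; lia.
pose r := m - ('C(n, k) - 'C(n - l, k)).
have rn : r <= n - l - k + 1 by rewrite leq_subLR.
have [L [K [R [[cL _ _] [e _ _ _]]]]] := lex_family_structure k0 lk rn.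
have em : m = 'C(n, k) - 'C(n - l, k) + r by rewrite subnKC.
have := @int_count_touching_ge 'I_n k L t.+2 k0 isT; rewrite cL card_ord => h.
apply: leq_trans h _; rewrite leq_add2r /best em e; apply: int_countS; exact: subsetUl.
Qed.

(** Induction on the number of missing full stars, and for a given [C] on the
    number of sets that the largest star outside [C] lacks. *)
Lemma int_count_le_lex_big (F : {set {set 'I_n}}) :
  F \subset kfam 'I_n k -> #|F| = m -> int_count F t.+2 <= best.
Proof.
have card_n : #|'I_n| = n by rewrite card_ord.
suff main d (C : {set 'I_n}) : l - #|C| = d -> #|C| <= l -> forall F : {set {set 'I_n}},
    F \subset kfam 'I_n k -> #|F| = m -> touching k C \subset F -> int_count F t.+2 <= best.
  move=> Fk Fm; apply: (main _ set0 erefl) => //; first by rewrite cards0.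
  by apply/subsetP => A; rewrite inE setI0 eqxx andbF.
clear F; elim: d C => [|d IHd] C ed Cl F0 F0k F0m CF0.
  have cC : #|C| = l by apply/eqP; rewrite eqn_leq Cl -subn_eq0 ed.
  rewrite /best -F0m; apply: (@int_count_full_le n k l (m - ('C(n, k) - 'C(n - l, k))) _ C) => //.
  - by move: nbig; rewrite /lex_threshold; clear; lia.
  - by rewrite leq_subLR.
  - by rewrite F0m subnKC.
have Cl' : #|C| < l by rewrite -subn_gt0 ed.
have [v0 v0C] : exists v, v \notin C.
  apply/existsP; rewrite -negb_forall; apply/negP => /forallP h.
  have : #|'I_n| <= #|C| by rewrite -cardsT; apply: subset_leq_card; apply/subsetP => x _; apply: h.
  by rewrite card_n; clear -Cl' lkn; lia.
have [e] := ubnP (N - deg F0 v0).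
elim: e F0 v0 v0C F0k F0m CF0 => // e IHe F v0 v0C Fk Fm CF; rewrite ltnS => he.
have [v vC vmax] := @arg_maxnP _ v0 (fun w => w \notin C) (fun w => deg F w) v0C.
have ks w : #|star (kfam 'I_n k) w| = N by rewrite card_kstar // card_n.
have {}he : N - deg F v <= e.
  by apply: leq_trans he; apply: leq_sub2l; apply: vmax.
have degN : deg F v <= N.
  rewrite -(ks v); apply: subset_leq_card; exact: starS.
have [degE|degL] := eqVneq (deg F v) N.
  apply: (IHd (v |: C)) => //; rewrite ?cardsU1 ?vC /=; [by rewrite add1n subnS ed|by []|].
  apply/subsetP => A; rewrite inE => /andP[Ak /interP[x xA /setU1P[xv|xC]]]; last first.
    by apply: (subsetP CF); rewrite inE Ak; apply/interP; exists x.
  have es : star F v = star (kfam 'I_n k) v.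
    by apply/eqP; rewrite eqEcard starS //= ks degE.
  have : A \in star (kfam 'I_n k) v by rewrite inE Ak -xv xA.
  by rewrite -es inE => /andP[].
have DN : deg F v < N by rewrite ltn_neqAle degL.
have next (F' : {set {set 'I_n}}) : F' \subset kfam 'I_n k -> #|F'| = #|F| -> touching k C \subset F' ->
    int_count F t.+2 <= int_count F' t.+2 -> deg F v < deg F' v -> int_count F t.+2 <= best.
  move=> F'k F'm CF' le lt; apply: leq_trans le _; apply: (IHe F' v vC) => //; first by rewrite F'm.
  by apply: leq_trans he; move: lt DN; clear; lia.
have kn : k <= #|'I_n| by rewrite card_n; clear -lkn; lia.
have hm : #|F| <= l.+1 * 'C(#|'I_n| - 1, k - 1) by rewrite Fm card_n.
have hN : star_bound k l * 'C(#|'I_n| - 2, k - 2) <= 'C(#|'I_n| - 1, k - 1) by rewrite card_n.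
have hb : l * 'C('C(#|'I_n| - 1, k - 1), t.+2) <= best + l * 'C(l * 'C(#|'I_n| - 2, k - 2), t.+2).
  by rewrite card_n.
have [small|Dbig] := leqP (heavy k l * deg F v) N.
  by apply: (@int_count_le_of_small_degree 'I_n k l t best C F v) => //; rewrite card_n.
have DN' : deg F v < 'C(#|'I_n| - 1, k - 1) by rewrite card_n.
have Dbig' : 'C(#|'I_n| - 1, k - 1) < heavy k l * deg F v by rewrite card_n.
have [/exists_inP[A AF /andP[/eqP AvC hA]]|] :=
   boolP [exists A in F, (A :&: (v |: C) == set0) && (#|meets (F :\ A) A| <= deg F v)].
  have [F' [h1 h2 h3 h4 h5]] := @swap_to_max 'I_n k t C F v k1 Fk CF DN' A AF AvC hA.
  exact: next h1 h2 h3 h4 h5.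
rewrite negb_exists_in => /forall_inP hstuck.
have stuck : {in F, forall A, A :&: (v |: C) = set0 -> deg F v < #|meets (F :\ A) A|}.
  by move=> A AF AvC; have := hstuck A AF; rewrite AvC eqxx /= ltnNge.
have hlow : 'C(#|'I_n|, k) - 'C(#|'I_n| - l, k) <= #|F| by rewrite card_n Fm.
case: (leqP k 2) => k2; last first.
  apply: (@int_count_le_of_stuck 'I_n k l t best C F v) => //.
  rewrite Fm card_n; apply: leq_trans m_linear _; rewrite leq_add2l.
  have : n - 2 <= 'C(n - 2, k - 2) by apply: leq_bin_self; clear -k2 lkn; lia.
  by clear -lkn; lia.
have ek : k = 2 by clear -k1 k2; lia.
pose H := heavy_points k C F v.
have cover : {in F, forall A, A :&: (C :|: H) != set0} by apply: (@heavy_cover _ k C F v).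
have few : #|C :|: H| <= heavy_count k l by apply: (@heavy_few _ k l C F v).
have many : l < #|C :|: H| by apply: (@heavy_many _ k l C F v).
have vH : v \in H by apply: (@heavy_max _ k C F v).
have CH : C :&: H = set0.
  by apply/eqP; rewrite -subset0; apply/subsetP => x /setIP[xC]; rewrite inE xC.
have big : {in H, forall w, #|C :|: H| ^ 2 + 2 * #|C :|: H| + 2 <= deg F w}.
  move=> w; rewrite inE => /andP[_ dw]; rewrite leqNgt; apply/negP => small.
  move: Dbig; apply/negP; rewrite -leqNgt.
  apply: leq_trans nN; apply: (@leq_trans (heavy k l * (k * graph_bound (heavy_count k l)))).
    rewrite leq_mul2l; apply/orP; right; apply: leq_trans dw _; rewrite leq_mul2l; apply/orP; right.
    apply: leq_trans (ltnW small) _; rewrite /graph_bound leq_add2r leq_add //.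
      by rewrite leq_sqr.
    by rewrite leq_mul2l few.
  by move: nbig; rewrite /lex_threshold ek; clear; lia.
have H2 : 1 < #|H|.
  by move: many; rewrite cardsU CH cards0 subn0; clear -Cl'; lia.
have Fk2 : F \subset kfam 'I_n 2 by rewrite -ek.
have CF2 : touching 2 C \subset F by rewrite -ek.
have DN2 : deg F v < #|'I_n| - 1 by move: DN'; rewrite ek bin1.
have [F' [h1 h2 h3 h4 h5]] := @graph_climb 'I_n F C H v t Fk2 CF2 CH vH cover H2 vmax DN2 big.
by apply: next h4 h5; rewrite ?ek.
Qed.

End Main.

Theorem proposition3p3 (k l : nat) (hk : 1 <= k) :
  exists n0 : nat, forall n : nat, n0 <= n -> forall t m : nat,
    'C(n, k) - 'C(n - l, k) <= m ->
    m <= 'C(n, k) - 'C(n - l, k) + (n - l - k + 1) ->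
    forall F : {set {set 'I_n}}, F \subset ksets n k -> #|F| = m ->
      int_count F t <= int_count (lex_family n k m) t.
Proof.
exists (lex_threshold k l) => n nbig t m mlow mhigh F Fk Fm.
have lkn : l + k + 5 <= n by apply: leq_trans nbig; rewrite /lex_threshold; clear; lia.
have lk : l + k <= n by clear -lkn; lia.
pose r := m - ('C(n, k) - 'C(n - l, k)).
have rn : r <= n - l - k + 1 by rewrite leq_subLR.
have em : m = 'C(n, k) - 'C(n - l, k) + r by rewrite subnKC.
have [L [K [R [[cL cK KL] [e cR Rk hR]]]]] := lex_family_structure hk lk rn.
rewrite -em in e.
have lexk : lex_family n k m \subset kfam 'I_n k by rewrite e subUset Rk andbT; apply: meets_sub.
have lexm : #|lex_family n k m| = m.
  rewrite e cardsU card_touching card_ord cL cR (_ : _ :&: R = set0) ?cards0 ?subn0 //.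
  apply/eqP; rewrite -subset0; apply/subsetP => A /setIP[]; rewrite inE => /andP[_ AL] /hR[_ AL'].
  by rewrite AL' eqxx in AL.
have no0 (G : {set {set 'I_n}}) : G \subset kfam 'I_n k -> set0 \notin G.
  by move=> Gk; apply/negP => /(subsetP Gk); rewrite inE cards0 => /eqP e0; rewrite -e0 in hk.
case: t => [|[|t]]; first by rewrite !int_count0.
  by rewrite !int_count1 ?no0 // Fm lexm.
have [k1|k1] := leqP k 1.
  have ek : k = 1 by apply/eqP; rewrite eqn_leq k1.
  rewrite int_countE (_ : intfams F t.+2 = set0) ?cards0 //; apply/setP => G; rewrite !inE.
  apply/negbTE/negP => /and3P[GF /eqP Gt /intersectingP Gi].
  have /card_gt1P[A [B [AG BG AB]]] : 1 < #|G| by rewrite Gt.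
  have sing D : D \in G -> exists x, D = [set x].
    move=> DG; have := subsetP Fk _ (subsetP GF _ DG); rewrite inE ek => /cards1P[x ->].
    by exists x.
  have [x eA] := sing _ AG; have [y eB] := sing _ BG.
  have /interP[z] := Gi _ _ AG BG; rewrite eA eB => /set1P-> /set1P exy.
  by rewrite eA eB exy eqxx in AB.
case: (posnP l) => [l0|l0]; last exact: (@int_count_le_lex_big n k l t m k1 l0).
apply: leq_trans (int_count_bin _ _) _.
rewrite Fm -[in X in X <= _]lexm -int_count_intersecting // e.
have -> : touching k L = set0.
  rewrite l0 in cL; rewrite (cards0_eq cL); apply/setP => A; by rewrite !inE setI0 eqxx andbF.
rewrite set0U; apply/intersectingP => A B /hR[KA _] /hR[KB _].
have /set0Pn[x xK] : K != set0 by rewrite -card_gt0 cK; clear -k1; lia.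
by apply/interP; exists x; [apply: (subsetP KA) | apply: (subsetP KB)].
Qed.
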